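(* Let $1\le p<\infty$ and let $g$ be an analytic polynomial. Let $\lambda_j\in\overline{\mathbb{D}}$ be the points of the closed unit disc where $g'(\lambda_j)=0$. The following hold: (a) If $|\lambda_j|\neq1$ for every $j$, then $[T_g,H^p]=[T_z,H^p]$. (b) If there exists an index $j$ such that $|\lambda_j|=1$, then $[T_z,H^p]\subsetneq[T_g,H^p]$.
   Context: $\mathbb{D}$ is the open unit disc of $\mathbb{C}$; $\mathrm{Hol}(\mathbb{D})$ is the set of holomorphic functions on $\mathbb{D}$. $H^p$ ($0<p<\infty$) is the Hardy space of $f\in\mathrm{Hol}(\mathbb{D})$ with $\|f\|_{H^p}^p=\sup_{0\le r<1}\int_0^{2\pi}|f(re^{it})|^p\frac{dt}{2\pi}<\infty$. An analytic polynomial is a polynomial in $z$ with complex coefficients. For $g,f\in\mathrm{Hol}(\mathbb{D})$, $T_g(f)(z)=\int_0^z f(\zeta)g'(\zeta)\,d\zeta$, and $[T_g,H^p]=\{f\in\mathrm{Hol}(\mathbb{D}): T_g(f)\in H^p\}$ is the holomorphic optimal domain. $T_z$ denotes $T_g$ for the symbol $g(z)=z$, i.e. $T_z(f)(w)=\int_0^w f(\zeta)\,d\zeta$. *)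

(* Defs.v *)
From mathcomp Require Import all_boot all_order all_algebra.
From mathcomp Require Import complex.
From mathcomp Require Import all_classical all_reals all_analysis.

Set Implicit Arguments.
Unset Strict Implicit.
Unset Printing Implicit Defensive.

Import Order.TTheory GRing.Theory Num.Theory.
Import numFieldNormedType.Exports.
Local Open Scope ring_scope.
Local Open Scope complex_scope.
Local Open Scope classical_set_scope.

(* Functions on the disc are total functions [R[i] -> R[i]]; every notion below
   depends only on their values on [unit_disc].  The topology and the
   derivative on [R[i]] are those of the normed space [R[i]^o] over [R[i]], so
   [derivable f z 1] is complex differentiability at [z]. *)

Definition unit_disc (R : realType) : set R[i] := [set z | `|z| < 1].

Definition Hol (R : realType) : set (R[i] -> R[i]) :=
  [set f | forall z, unit_disc z -> derivable (f : R[i]^o -> R[i]^o) z 1].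

Definition cderiv (R : realType) (f : R[i] -> R[i]) : R[i] -> R[i] :=
  (f : R[i]^o -> R[i]^o)^`().

Definition cint (R : realType) (A : set R) (phi : R -> R[i]) : R[i] :=
  (\int[lebesgue_measure]_(t in A) complex.Re (phi t))%R +i*
  (\int[lebesgue_measure]_(t in A) complex.Im (phi t))%R.

(* Integral of [h] along the segment [0, z], parametrized by [t |-> t * z]. *)
Definition segint (R : realType) (h : R[i] -> R[i]) (z : R[i]) : R[i] :=
  cint `[0, 1] (fun t => h (t%:C * z) * z).

Definition Tvolterra (R : realType) (g f : R[i] -> R[i]) : R[i] -> R[i] :=
  segint (fun zeta => f zeta * cderiv g zeta).

Definition polar (R : realType) (r t : R) : R[i] :=
  (r * cos t) +i* (r * sin t).

Definition hardy_mean (R : realType) (p : R) (f : R[i] -> R[i]) (r : R)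
    : \bar R :=
  (\int[lebesgue_measure]_(t in `[0%R, (2 * pi)%R])
     (complex.Re `|f (polar r t)| `^ p / (2 * pi))%:E)%E.

(* The p-th power of the H^p norm. *)
Definition hardy_normp (R : realType) (p : R) (f : R[i] -> R[i]) : \bar R :=
  ereal_sup [set hardy_mean p f r | r in [set r : R | 0 <= r < 1]].

Definition Hardy (R : realType) (p : R) : set (R[i] -> R[i]) :=
  [set f | Hol f /\ (hardy_normp p f < +oo)%E].

Definition optdom (R : realType) (g : R[i] -> R[i]) (p : R)
    : set (R[i] -> R[i]) :=
  [set f | Hol f /\ Hardy p (Tvolterra g f)].

(* Main.v *)
(** [F = T_z f] and [G = T_g f] are primitives of [f] and [f g'] on the disc,
    by Goursat's theorem on triangles. Hence [G - F g'] has derivative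
    [- F g''], so that [`|G z|] is at most [A + B `|F z|] plus [B] times the
    integral of [`|F (s z)|] over [s] in [[0, 1]]; on circles, Jensen and
    Tonelli turn this into a bound of the [H^p] mean of [G] by that of [F]. If
    [g'] has no zero on the unit circle, then [1 / g'] and its derivative are
    bounded on an annulus [rho <= `|z| <= 1], and the same argument applied to
    [F - G / g'] on the part of each ray inside the annulus gives the converse:
    the zeros of [g'] inside the disc play no role, because [F] and [G] are
    bounded there. If [g' l = 0] with [`|l| = 1], the function
    [f w = (l - w)^-2] separates the two domains: [`|F z| = `|z| / `|l - z|],
    whose circular means diverge at least logarithmically, while [f g'] has
    only a simple pole at [l], so that [G] grows like [ln (1 / `|l - z|)] and
    [`|G| `^ p = O(`|l - z| `^ (-1/2))]. *)

Require Import Defs.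
From mathcomp Require Import all_boot all_order all_algebra.
From mathcomp Require Import complex.
From mathcomp Require Import all_classical all_reals all_analysis.
From mathcomp Require Import measurable_realfun.
From mathcomp Require Import ring lra.

Set Implicit Arguments.
Unset Strict Implicit.
Unset Printing Implicit Defensive.

Import Order.TTheory GRing.Theory Num.Theory.
Import numFieldNormedType.Exports.
Local Open Scope ring_scope.
Local Open Scope complex_scope.
Local Open Scope classical_set_scope.
Import ComplexField.Normc.

(** * Complex derivatives *)

(** [Hol] gives differentiability at each point and nothing on the continuity of the derivative, so
    primitives cannot be obtained from Green's formula. Once they exist, no further Cauchy theory
    enters: [G - F g'] is chosen because its derivative contains neither [f] nor [f'], only [F]. The
    radial integral needs no maximal function, since the circles of radius [s r] obey the same bound
    on means as the circle of radius [r]; convexity of the power [p] is used there. For the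
    separating function, non-membership reduces to the exponent 1 through [x <= x^p + 1]. The
    exponent 1/2 is one choice below 1, so that a single integrable kernel serves every [p]. This
    kernel is replaced by a smooth majorant with an explicit primitive: circular means are then
    bounded by the fundamental theorem of calculus, uniformly as the radius tends to 1. *)

Lemma is_derive_epsP (K : numFieldType) (f : K -> K) (z d : K) :
  is_derive (z : K^o) 1 (f : K^o -> K^o) d <->
  forall e, 0 < e -> exists2 r, 0 < r &
    forall w, `|w - z| < r -> `|f w - f z - d * (w - z)| <= e * `|w - z|.
Proof.
split=> [[fz dE] e e0|H].
  have /cvgrPdist_le/(_ _ e0) :
    h^-1 *: (((f : K^o -> K^o) \o shift z) (h *: (1 : K^o)) - f z)
      @[h --> 0^'] --> (d : K^o).
    by rewrite -dE; exact: fz.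
  move=> /nbhs_ballP[r /= r0 Hr]; exists r => // w wz.
  have [->|wNz] := eqVneq w z; first by rewrite !subrr mulr0 subrr normr0 mulr0.
  have wz0 : w - z != 0 by rewrite subr_eq0.
  have := Hr (w - z); rewrite /ball /= sub0r normrN => /(_ wz wz0).
  rewrite /shift /= {1}/GRing.scale /= /GRing.scale /= mulr1 subrK => Hw.
  have -> : f w - f z - d * (w - z) =
      - (d - (w - z)^-1 * (f w - f z)) * (w - z).
    by field.
  by rewrite normrM normrN ler_wpM2r.
have cv : h^-1 *: (((f : K^o -> K^o) \o shift z) (h *: (1 : K^o)) - f z)
      @[h --> 0^'] --> (d : K^o).
  apply/cvgrPdist_le => e e0; have [r r0 Hr] := H _ e0.
  apply/nbhs_ballP; exists r => //= h; rewrite /ball /= sub0r normrN => hr h0.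
  rewrite /shift /= /GRing.scale /= mulr1.
  have := Hr (h + z); rewrite addrK => /(_ hr) Hh.
  have -> : d - h^-1 * (f (h + z) - f z) =
      - h^-1 * (f (h + z) - f z - d * h) :> K.
    by field.
  by rewrite normrM normrN normfV mulrC ler_pdivrMr // normr_gt0.
by apply: DeriveDef; [apply: cvgP cv|apply: cvg_lim cv => //].
Qed.

Section complex_derivative.
Variable R : realType.
Implicit Types (f g : R[i] -> R[i]) (z w d : R[i]) (phi : R -> R[i]).

Lemma normcE z : `|z| = (normc z)%:C. Proof. by []. Qed.

Lemma normc_ge0 z : 0 <= normc z.
Proof. by rewrite -ler0c -normcE. Qed.

Lemma normc_eq0 z : (normc z == 0) = (z == 0).
Proof. by rewrite -(normr_eq0 z) normcE; apply/eqP/eqP => [->//|[]]. Qed.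

Lemma normcB z w : normc (z - w) = normc (w - z).
Proof. by apply: complexI; rewrite -!normcE distrC. Qed.

Lemma normc_real (x : R) : normc x%:C = `|x|.
Proof. by rewrite /normc /= expr0n addr0 sqrtr_sqr. Qed.

Lemma ler_normcB z w : normc (z - w) <= normc z + normc w.
Proof. by rewrite -lecR rmorphD -!normcE ler_normB. Qed.

Lemma lerB_normc z w : normc z - normc w <= normc (z - w).
Proof. by rewrite lerBlDr -{1}(subrK w z) le_normcD. Qed.

Lemma unit_discE z : unit_disc z <-> normc z < 1.
Proof. by rewrite /unit_disc /= normcE (ltcR _ 1). Qed.

Lemma normc_Re z : `|complex.Re z| <= normc z.
Proof. by rewrite -lecR; exact: normc_ge_Re. Qed.

Lemma normc_Im z : `|complex.Im z| <= normc z.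
Proof.
case: z => a b /=; rewrite -sqrtr_sqr ler_wsqrtr // lerDr sqr_ge0 //.
Qed.

(** The bounds live in [R], whereas the norm of [R[i]] is itself a complex number; linear arithmetic
    over [R] then applies to every estimate. *)
Definition cdiff f z d := forall e : R, 0 < e -> exists2 r : R, 0 < r &
  forall w, normc (w - z) < r ->
    normc (f w - f z - d * (w - z)) <= e * normc (w - z).

Lemma cdiffP f z d :
  is_derive (z : R[i]^o) 1 (f : R[i]^o -> R[i]^o) d <-> cdiff f z d.
Proof.
rewrite is_derive_epsP; split => H e e0.
  have e0' : 0 < e%:C by rewrite ltcR.
  have [r r0 Hr] := H _ e0'.
  (* The order of [R[i]] only compares numbers with equal imaginary parts, so a positive [r] is
     real. *)
  have rE : r = (complex.Re r)%:C by rewrite RRe_real // realE ltW.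
  rewrite rE ltcR in r0; exists (complex.Re r) => // w wz.
  by rewrite -lecR rmorphM -!normcE Hr // rE normcE ltcR.
have eE : e = (complex.Re e)%:C by rewrite RRe_real // realE ltW.
rewrite eE ltcR in e0; have [r r0 Hr] := H _ e0.
exists r%:C => [|w]; first by rewrite ltcR.
by rewrite !normcE ltcR => /Hr; rewrite eE -rmorphM lecR.
Qed.

Lemma cdiff_Hol f : (forall z, unit_disc z -> exists d, cdiff f z d) -> Hol f.
Proof. by move=> H z /H[d /cdiffP[]]. Qed.

Lemma Hol_cdiff f z : Hol f -> unit_disc z -> exists d, cdiff f z d.
Proof.
move=> Hf /Hf fz; exists ('D_1 (f : R[i]^o -> R[i]^o) z); apply/cdiffP.
exact: DeriveDef.
Qed.

Lemma cdiff_cderiv f z d : cdiff f z d -> cderiv f z = d.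
Proof. by move=> /cdiffP[_ <-]; rewrite /cderiv derive1E. Qed.

Lemma cdiff_cst c z : cdiff (fun=> c) z 0.
Proof. by apply/cdiffP; exact: is_derive_cst. Qed.

Lemma cdiff_id z : cdiff id z 1.
Proof. by apply/cdiffP; exact: is_derive_id. Qed.

Lemma cdiffD f g z df dg : cdiff f z df -> cdiff g z dg ->
  cdiff (fun w => f w + g w) z (df + dg).
Proof. by move=> /cdiffP Hf /cdiffP Hg; apply/cdiffP; exact: is_deriveD. Qed.

Lemma cdiffN f z df : cdiff f z df -> cdiff (fun w => - f w) z (- df).
Proof. by move=> /cdiffP Hf; apply/cdiffP; exact: is_deriveN. Qed.

Lemma cdiffM f g z df dg : cdiff f z df -> cdiff g z dg ->
  cdiff (fun w => f w * g w) z (df * g z + f z * dg).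
Proof.
move=> /cdiffP Hf /cdiffP Hg; apply/cdiffP.
rewrite addrC mulrC; rewrite mulrC (mulrC df).
exact: (@is_deriveM _ _ (f : R[i]^o -> R[i]) (g : R[i]^o -> R[i])).
Qed.

Lemma cdiff_horner (p : {poly R[i]}) z : cdiff (horner p) z p^`().[z].
Proof.
elim/poly_ind: p => [|p c ih].
  rewrite deriv0 horner0; suff -> : horner (0 : {poly R[i]}) = fun=> 0.
    exact: cdiff_cst.
  by apply/funext => w; rewrite horner0.
have -> : horner (p * 'X + c%:P) = fun w => p.[w] * w + c.
  by apply/funext => w; rewrite !hornerE.
rewrite derivD derivM derivX derivC addr0 mulr1 !hornerE.
rewrite -[X in cdiff _ _ X]addr0; apply: cdiffD (cdiff_cst _ _).
rewrite -[X in _ + X]mulr1; exact: cdiffM (cdiff_id _).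
Qed.

Lemma cdiff_continuous f z d : cdiff f z d -> forall e : R, 0 < e ->
  exists2 r : R, 0 < r & forall w, normc (w - z) < r -> normc (f w - f z) < e.
Proof.
move=> H e e0; have [r r0 Hr] := H _ ltr01.
have d1 : 0 < 1 + normc d by rewrite ltr_wpDr ?normc_ge0.
exists (Num.min r (e / (1 + normc d))); first by rewrite lt_min r0 divr_gt0.
move=> w; rewrite lt_min => /andP[/Hr wr]; rewrite ltr_pdivlMr // => we.
apply: le_lt_trans we; rewrite -(subrK (d * (w - z)) (f w - f z)).
rewrite mul1r in wr; apply: le_trans (le_normcD _ _) _.
by rewrite normcM [X in _ <= X]mulrDr mulr1 [X in _ <= _ + X]mulrC lerD.
Qed.

Lemma cdiffV f z d : cdiff f z d -> f z != 0 ->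
  cdiff (fun w => (f w)^-1) z (- d / f z ^+ 2).
Proof.
move=> Hf fz0; have n0 : 0 < normc (f z).
  by rewrite lt_def normc_eq0 fz0 normc_ge0.
set n := normc (f z) in n0; pose M := 1 + normc d.
have M0 : 0 < M by rewrite ltr_wpDr ?normc_ge0.
move=> e e0.
have n2 : 0 < n / 2 by rewrite divr_gt0.
have [r1 r10 H1] := cdiff_continuous Hf n2.
have [r2 r20 H2] := Hf _ ltr01.
have e3 : 0 < e * n ^+ 2 / 4 by rewrite divr_gt0 // mulr_gt0 // exprn_gt0.
have [r3 r30 H3] := Hf _ e3.
(* This bound on [|w - z|] makes the quadratic term below at most [e / 2 * |w - z|], because
   [|f w - f z| <= M * |w - z|] and [|f w| >= n / 2]. *)
have e4 : 0 < e * n ^+ 3 / (4 * M ^+ 2).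
  by rewrite divr_gt0 // mulr_gt0 // exprn_gt0.
exists (Num.min (Num.min r1 r2) (Num.min r3 (e * n ^+ 3 / (4 * M ^+ 2)))).
  by rewrite !lt_min r10 r20 r30.
move=> w; rewrite !lt_min => /andP[/andP[/H1 w1 /H2 w2] /andP[/H3 w3 w4]].
have fw : n / 2 <= normc (f w).
  have := lerB_normc (f z) (f w); rewrite normcB -/n; lra.
have fw0 : f w != 0 by rewrite -normc_eq0 gt_eqF // (lt_le_trans n2).
(* The remainder of [1 / f] is that of [f] divided by [f z ^+ 2], up to a term quadratic in
   [f w - f z]. *)
have -> : (f w)^-1 - (f z)^-1 - - d / f z ^+ 2 * (w - z) =
   (f w - f z) ^+ 2 / (f z ^+ 2 * f w) -
   (f w - f z - d * (w - z)) / (f z ^+ 2).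
  by field; rewrite fz0 fw0.
apply: le_trans (ler_normcB _ _) _.
set x := normc (w - z) in w1 w2 w3 w4 *.
have x0 : 0 <= x by exact: normc_ge0.
have w2' : normc (f w - f z) <= M * x.
  rewrite -(subrK (d * (w - z)) (f w - f z)).
  rewrite mul1r in w2; apply: le_trans (le_normcD _ _) _.
  by rewrite normcM [X in _ <= X]mulrDl mul1r lerD.
rewrite [e](_ : _ = e / 2 + e / 2); last by field.
rewrite [X in _ <= X]mulrDl lerD //.
  rewrite !normcM !normcV !normcM -/n ler_pdivrMr; last first.
    by rewrite mulr_gt0 ?mulr_gt0 // (lt_le_trans n2).
  apply: (@le_trans _ _ ((M * x) * (M * x))).
    by apply: ler_pM => //; exact: normc_ge0.
  apply: (@le_trans _ _ (e / 2 * x * (n * n * (n / 2)))); last first.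
    apply: ler_wpM2l; first by rewrite mulr_ge0 // divr_ge0 // ltW.
    by apply: ler_wpM2l => //; rewrite mulr_ge0 // ltW.
  have : x * (4 * M ^+ 2) <= e * n ^+ 3.
    by rewrite -ler_pdivlMr ?mulr_gt0 ?exprn_gt0 // ltW.
  move=> /(ler_wpM2l x0); lra.
rewrite !normcM !normcV !normcM -/n ler_pdivrMr ?mulr_gt0 //.
apply: le_trans w3 _.
have : 0 <= e * n ^+ 2 * x.
  by rewrite mulr_ge0 // mulr_ge0 ?exprn_ge0 // ltW.
lra.
Qed.

End complex_derivative.

(** * Curves and integrals over an interval *)

Section curves.
Variable R : realType.
Implicit Types (f g : R[i] -> R[i]) (z w d : R[i]) (phi Phi : R -> R[i]).
Local Notation mu := (@lebesgue_measure R).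

(** Componentwise, as in [cint]: a curve has a real parameter, while [R[i]] carries its normed
    structure over itself. *)
Definition rder phi t d :=
  is_derive t (1 : R) (fun s => complex.Re (phi s)) (complex.Re d) /\
  is_derive t (1 : R) (fun s => complex.Im (phi s)) (complex.Im d).

Definition rcont phi t :=
  {for t, continuous (fun s => complex.Re (phi s))} /\
  {for t, continuous (fun s => complex.Im (phi s))}.

Lemma is_derive_continuous (h : R -> R) (t d : R) :
  is_derive t (1 : R) h d -> {for t, continuous h}.
Proof. by move=> [/derivable1_diffP/differentiable_continuous]. Qed.

Lemma rder_cont phi t d : rder phi t d -> rcont phi t.
Proof. by move=> [] /is_derive_continuous ? /is_derive_continuous. Qed.

Lemma rderB phi psi t d e : rder phi t d -> rder psi t e ->
  rder (fun s => phi s - psi s) t (d - e).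
Proof.
move=> [p1 p2] [q1 q2]; have rI : forall z w, complex.Im (z - w) =
  complex.Im z - complex.Im w by move=> [? ?] [].
have rR : forall z w, complex.Re (z - w) =
  complex.Re z - complex.Re w by move=> [? ?] [].
split; rewrite ?rI ?rR.
  by under eq_fun do rewrite rR; exact: is_deriveB.
by under eq_fun do rewrite rI; exact: is_deriveB.
Qed.

Lemma rder_affine phi (c k t : R) d : rder phi (c + k * t) d ->
  rder (fun s => phi (c + k * s)) t (k%:C * d).
Proof.
have H : is_derive t (1 : R) (fun s : R => c + k * s) k.
  have := is_deriveD (is_derive_cst c t (1 : R))
    (is_deriveZ k (is_derive_id t (1 : R))).
  by rewrite add0r /GRing.scale /= mulr1.
move=> [p1 p2]; split.
  have -> : complex.Re (k%:C * d) = complex.Re d * k.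
    by case: d {p1 p2} => ? ? /=; rewrite mul0r subr0 mulrC.
  exact: (@is_derive1_comp R (fun s => complex.Re (phi s))
    (fun s => c + k * s)).
have -> : complex.Im (k%:C * d) = complex.Im d * k.
  by case: d {p1 p2} => ? ? /=; rewrite mul0r addr0 mulrC.
exact: (@is_derive1_comp R (fun s => complex.Im (phi s))
  (fun s => c + k * s)).
Qed.

Lemma rder_line f a b (t : R) d : cdiff f (a + t%:C * b) d ->
  rder (fun s => f (a + s%:C * b)) t (d * b).
Proof.
(* The added 1 keeps [M] positive when [b = 0]. *)
move=> H; pose M := 1 + normc b.
have M0 : 0 < M by rewrite ltr_wpDr ?normc_ge0.
have bM : normc b <= M by rewrite lerDr.
have K (e : R) : 0 < e -> exists2 r, 0 < r & forall s, `|s - t| < r ->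
    normc (f (a + s%:C * b) - f (a + t%:C * b) - d * b * (s - t)%:C)
      <= e * `|s - t|.
  move=> e0; have [|r r0 Hr] := H (e / M); first by rewrite divr_gt0.
  exists (r / M) => [|s]; first by rewrite divr_gt0.
  rewrite ltr_pdivlMr // => st.
  have E : a + s%:C * b - (a + t%:C * b) = (s - t)%:C * b.
    by rewrite rmorphB; ring.
  have := Hr (a + s%:C * b); rewrite E normcM normc_real.
  have sM : `|s - t| * normc b <= `|s - t| * M by rewrite ler_wpM2l.
  move=> /(_ (le_lt_trans sM st)).
  have -> : d * ((s - t)%:C * b) = d * b * (s - t)%:C by ring.
  move=> /le_trans; apply; rewrite mulrAC ler_pdivrMr // -[leRHS]mulrA.
  by rewrite ler_wpM2l // ltW.
split.
  apply/(@is_derive_epsP R (fun s => complex.Re (f (a + s%:C * b)))).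
  move=> e /K[r r0 Hr]; exists r => // s /Hr; apply: le_trans.
  apply: le_trans (normc_Re _).
  case: (f _) => ? ?; case: (f _) => ? ?; case: (d * b) => ? ? /=.
  by rewrite mulr0 subr0.
apply/(@is_derive_epsP R (fun s => complex.Im (f (a + s%:C * b)))).
move=> e /K[r r0 Hr]; exists r => // s /Hr; apply: le_trans.
apply: le_trans (normc_Im _).
case: (f _) => ? ?; case: (f _) => ? ?; case: (d * b) => ? ? /=.
by rewrite mulr0 add0r.
Qed.

(* Differentiate the component of [Phi] in the direction [Phi b - Phi a]. *)
Lemma rder_le Phi phi (K k : R -> R) (a b : R) : a <= b ->
  (forall t, a <= t <= b -> rder Phi t (phi t)) ->
  (forall t, a <= t <= b -> is_derive t (1 : R) K (k t)) ->
  (forall t, a <= t <= b -> normc (phi t) <= k t) ->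
  normc (Phi b - Phi a) <= K b - K a.
Proof.
move=> ab HPhi HK Hk; set D := Phi b - Phi a.
have K0 : 0 <= K b - K a.
  rewrite subr_ge0; apply: (@ger0_derive1_ndecr _ K a b) => //.
  - by move=> x; rewrite in_itv => /andP[/ltW ? /ltW ?]; case: (HK x);
      rewrite ?in_itv //; apply/andP.
  - move=> x; rewrite in_itv => /andP[/ltW ax /ltW xb].
    have axb : a <= x <= b by rewrite ax.
    rewrite derive1E; case: (HK x axb) => _ ->.
    by rewrite (le_trans (normc_ge0 _) (Hk x axb)).
  - apply: derivable_within_continuous => x; rewrite in_itv /= => axb.
    by case: (HK x axb).
have [->|D0] := eqVneq D 0.
  by rewrite (_ : normc 0 = 0) //; apply/eqP; rewrite normc_eq0.
have N0 : 0 < normc D by rewrite lt_def normc_eq0 D0 normc_ge0.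
set N := normc D in N0 *; pose x := complex.Re D; pose y := complex.Im D.
pose h t := K t - (x / N * complex.Re (Phi t) + y / N * complex.Im (Phi t)).
have hD t : a <= t <= b -> is_derive t (1 : R) h
    (k t - (x / N * complex.Re (phi t) + y / N * complex.Im (phi t))).
  move=> tab; have [P1 P2] := HPhi t tab; have Kt := HK t tab.
  exact: (is_deriveB Kt (is_deriveD (is_deriveZ _ P1) (is_deriveZ _ P2))).
have N2 : N ^+ 2 = x ^+ 2 + y ^+ 2.
  rewrite /N /x /y; case: (D) => u v /=.
  by rewrite sqr_sqrtr // addr_ge0 // sqr_ge0.
have : h a <= h b.
  apply: (@ger0_derive1_ndecr _ h a b) => //.
  - move=> t; rewrite in_itv => /andP[/ltW ta /ltW tb].
    by case: (hD t); rewrite ?ta.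
  - move=> t; rewrite in_itv => /andP[/ltW ta /ltW tb].
    have tab : a <= t <= b by rewrite ta.
    rewrite derive1E; case: (hD t tab) => _ ->; rewrite subr_ge0.
    apply: le_trans (Hk _ tab).
    have -> : x / N * complex.Re (phi t) + y / N * complex.Im (phi t) =
       complex.Re (phi t * D^*) / N.
      rewrite /x /y; case: (phi t) => ? ?; case: (D) => ? ? /=.
      by field; rewrite gt_eqF.
    rewrite ler_pdivrMr //; apply: le_trans (ler_norm _) _.
    apply: le_trans (normc_Re _) _; rewrite normcM.
    suff -> : normc D^* = N by [].
    by rewrite /N; case: (D) => ? ? /=; rewrite sqrrN.
  - apply: derivable_within_continuous => t; rewrite in_itv /= => tab.
    by case: (hD t tab).
rewrite /h lerBrDr -lerBrDl => h1.
suff <- : x / N * complex.Re (Phi b) + y / N * complex.Im (Phi b) -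
   (x / N * complex.Re (Phi a) + y / N * complex.Im (Phi a)) = N by lra.
transitivity ((x ^+ 2 + y ^+ 2) / N); last first.
  by rewrite -N2 expr2 mulfK // gt_eqF.
rewrite /x /y /D; case: (Phi b) => ? ?; case: (Phi a) => ? ? /=.
by field; rewrite gt_eqF.
Qed.

Lemma Rint_FTC2 (h H : R -> R) (a b : R) : a < b ->
  (forall t, a <= t <= b -> {for t, continuous h}) ->
  (forall t, a <= t <= b -> is_derive t (1 : R) H (h t)) ->
  (\int[mu]_(t in `[a, b]) (h t)%:E = (H b - H a)%:E)%E.
Proof.
move=> ab ch dH; rewrite EFinB; apply: continuous_FTC2 => //.
- apply: continuous_in_subspaceT => t; rewrite inE /= in_itv /= => /ch.
  by [].
- have aab : a <= a <= b by rewrite lexx ltW.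
  have bab : a <= b <= b by rewrite lexx ltW.
  split.
  + move=> t; rewrite in_itv /= => /andP[/ltW ta /ltW tb].
    by case: (dH t); rewrite ?ta.
  + apply: cvg_at_right_filter; exact: (is_derive_continuous (dH a aab)).
  + apply: cvg_at_left_filter; exact: (is_derive_continuous (dH b bab)).
- move=> t; rewrite in_itv /= => /andP[/ltW ta /ltW tb].
  by rewrite derive1E; case: (dH t); rewrite ?ta.
Qed.

Lemma continuous_primitive (h : R -> R) (a b : R) : continuous h ->
  exists H : R -> R, forall t, a <= t <= b -> is_derive t (1 : R) H (h t).
Proof.
move=> ch; exists (fun x => \int[mu]_(t in `[a - 1, x]) h t).
move=> t /andP[ta tb].
have [||||dH HE] := @continuous_FTC1_closed R h (a - 1) t (b + 1).
- lra.
- apply: continuous_compact_integrable; first exact: segment_compact.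
  exact: continuous_subspaceT.
- lra.
- exact: ch.
- exact: DeriveDef dH (etrans (esym (derive1E _ _)) HE).
Qed.

(** Retraction of the line onto [0, 1]. Composing with it turns an integrand that is controlled only
    on [0, 1] into one continuous everywhere, with the same integral over [0, 1]. *)
Definition clamp (t : R) := Num.max 0 (Num.min 1 t).

Lemma clamp_id t : 0 <= t <= 1 -> clamp t = t.
Proof.
by move=> /andP[t0 t1]; rewrite /clamp (min_idPr t1) (max_idPr t0).
Qed.

Lemma clamp_itv t : 0 <= clamp t <= 1.
Proof. by rewrite /clamp le_max lexx /= ge_max ler01 ge_min lexx. Qed.

Lemma clamp_continuous : continuous clamp.
Proof.
move=> t; rewrite /clamp; apply: continuous_max; first exact: cvg_cst.
by apply: continuous_min; [exact: cvg_cst|exact: cvg_id].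
Qed.

Lemma clamp_comp_continuous (h : R -> R) :
  (forall t, 0 <= t <= 1 -> {for t, continuous h}) ->
  continuous (h \o clamp).
Proof.
move=> ch t; apply: continuous_comp; first exact: clamp_continuous.
exact/ch/clamp_itv.
Qed.

Lemma cint_rder Phi phi : (forall t, 0 <= t <= 1 -> rcont phi t) ->
  (forall t, 0 <= t <= 1 -> rder Phi t (phi t)) ->
  cint `[0, 1] phi = Phi 1 - Phi 0.
Proof.
move=> cphi dPhi.
have R1 := @Rint_FTC2 (fun s => complex.Re (phi s))
  (fun s => complex.Re (Phi s)) 0 1 ltr01
  (fun t tI => proj1 (cphi t tI)) (fun t tI => proj1 (dPhi t tI)).
have R2 := @Rint_FTC2 (fun s => complex.Im (phi s))
  (fun s => complex.Im (Phi s)) 0 1 ltr01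
  (fun t tI => proj2 (cphi t tI)) (fun t tI => proj2 (dPhi t tI)).
rewrite /cint /Rintegral R1 R2 /=.
by case: (Phi 1) => ? ?; case: (Phi 0).
Qed.

Lemma rcont_primitive phi : (forall t, 0 <= t <= 1 -> rcont phi t) ->
  exists Phi, forall t, 0 <= t <= 1 -> rder Phi t (phi t).
Proof.
move=> cphi.
have [|H1 h1] :=
    @continuous_primitive (fun t => complex.Re (phi (clamp t))) 0 1.
  apply: (@clamp_comp_continuous (fun t => complex.Re (phi t))).
  by move=> t /cphi[].
have [|H2 h2] :=
    @continuous_primitive (fun t => complex.Im (phi (clamp t))) 0 1.
  apply: (@clamp_comp_continuous (fun t => complex.Im (phi t))).
  by move=> t /cphi[].
exists (fun t => H1 t +i* H2 t) => t t01.
by split => /=; rewrite -[in X in is_derive _ _ _ X](clamp_id t01);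
  [exact: h1|exact: h2].
Qed.

End curves.

(** * Goursat's theorem on the disc *)

Section goursat.
Variable R : realType.
Implicit Types (f g : R[i] -> R[i]) (a b c z w d : R[i]).

Lemma ler_normc_ReIm z : normc z <= `|complex.Re z| + `|complex.Im z|.
Proof.
case: z => x y /=; rewrite -(@ler_pXn2r _ 2) ?nnegrE ?addr_ge0 ?sqrtr_ge0 //.
rewrite sqr_sqrtr ?addr_ge0 ?sqr_ge0 // sqrrD !real_normK ?num_real //.
by rewrite addrAC lerDl mulrn_wge0 // mulr_ge0.
Qed.

Lemma normc_segment a b z (t rho : R) : 0 <= t <= 1 ->
  normc (a - z) <= rho -> normc (b - z) <= rho ->
  normc (a + t%:C * (b - a) - z) <= rho.
Proof.
move=> /andP[t0 t1] az bz.
have -> : a + t%:C * (b - a) - z = (1 - t)%:C * (a - z) + t%:C * (b - z).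
  by rewrite rmorphB rmorph1; ring.
apply: le_trans (le_normcD _ _) _; rewrite !normcM !normc_real.
rewrite (ger0_norm t0) ger0_norm ?subr_ge0 //.
have := ler_wpM2l t0 bz; have t1' : 0 <= 1 - t by rewrite subr_ge0.
have := ler_wpM2l t1' az; lra.
Qed.

Lemma unit_disc_segment a b (t : R) : 0 <= t <= 1 ->
  unit_disc a -> unit_disc b -> unit_disc (a + t%:C * (b - a)).
Proof.
move=> t01 /unit_discE a1 /unit_discE b1; apply/unit_discE.
apply: (@le_lt_trans _ _ (Num.max (normc a) (normc b))); last first.
  by rewrite gt_max a1.
rewrite -[X in normc X]subr0; apply: normc_segment => //.
  by rewrite subr0 le_max lexx.
by rewrite subr0 le_max lexx orbT.
Qed.

Definition seg f a b :=
  cint `[0, 1] (fun t : R => f (a + t%:C * (b - a)) * (b - a)).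

Lemma segintE f z : segint f z = seg f 0 z.
Proof.
by rewrite /segint /seg; congr cint; apply/funext => t; rewrite add0r subr0.
Qed.

Lemma seg_rcont f a b (t : R) : Hol f -> unit_disc a -> unit_disc b ->
  0 <= t <= 1 -> rcont (fun t : R => f (a + t%:C * (b - a)) * (b - a)) t.
Proof.
move=> hf a1 b1 t01.
have [d fd] := Hol_cdiff hf (unit_disc_segment t01 a1 b1).
have := rder_line (cdiffM fd (cdiff_cst (b - a) _)).
exact: rder_cont.
Qed.

(** A primitive of the integrand along one segment, not of [f] on the disc: it handles all
    subsegments at once, so reversal and bisection become algebra on [Phi]. *)
Lemma seg_primitive f a b : Hol f -> unit_disc a -> unit_disc b ->
  exists2 Phi : R -> R[i],
    forall t, 0 <= t <= 1 -> rder Phi t (f (a + t%:C * (b - a)) * (b - a)) &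
    forall u v : R, 0 <= u <= 1 -> 0 <= v <= 1 ->
      seg f (a + u%:C * (b - a)) (a + v%:C * (b - a)) = Phi v - Phi u.
Proof.
move=> hf a1 b1.
have [Phi dPhi] := rcont_primitive (fun t => @seg_rcont f a b t hf a1 b1).
exists Phi => // u v u01 v01; rewrite /seg.
have := @cint_rder R (fun t => Phi (u + (v - u) * t)).
rewrite mulr1 mulr0 addr0 subrKC; apply => t t01.
  by apply: seg_rcont => //; exact: unit_disc_segment.
have w01 : 0 <= u + (v - u) * t <= 1.
  case/andP: u01 => u0 u1; case/andP: v01 => v0 v1; case/andP: t01 => t0 t1.
  have := mulr_ge0 t0 v0; have t1' : 0 <= 1 - t by rewrite subr_ge0.
  have := mulr_ge0 t1' u0.
  have := ler_wpM2l t0 v1; have := ler_wpM2l t1' u1; lra.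
have := rder_affine (dPhi _ w01); congr rder.
have -> : a + v%:C * (b - a) - (a + u%:C * (b - a)) = (v - u)%:C * (b - a).
  by rewrite rmorphB; ring.
have -> : a + u%:C * (b - a) + t%:C * ((v - u)%:C * (b - a)) =
          a + (u + (v - u) * t)%:C * (b - a).
  by rewrite [(_ + _ * _)%:C]rmorphD; ring.
by ring.
Qed.

Let itv0 : 0 <= (0 : R) <= 1. Proof. by rewrite lexx ler01. Qed.
Let itv1 : 0 <= (1 : R) <= 1. Proof. by rewrite lexx ler01. Qed.

Lemma seg_rev f a b : Hol f -> unit_disc a -> unit_disc b ->
  seg f b a = - seg f a b.
Proof.
move=> hf a1 b1; have [Phi _ E] := seg_primitive hf a1 b1.
have := E 0 1 itv0 itv1; have := E 1 0 itv1 itv0.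
by rewrite rmorph0 rmorph1 mul0r mul1r addr0 subrKC => -> ->; rewrite opprB.
Qed.

Definition mid a b := a + (2^-1 : R)%:C * (b - a).

Lemma seg_mid f a b : Hol f -> unit_disc a -> unit_disc b ->
  seg f a b = seg f a (mid a b) + seg f (mid a b) b.
Proof.
move=> hf a1 b1; have [Phi _ E] := seg_primitive hf a1 b1.
have h01 : 0 <= (2^-1 : R) <= 1 by lra.
have := E 0 1 itv0 itv1; have := E 0 2^-1 itv0 h01; have := E 2^-1 1 h01 itv1.
rewrite rmorph0 rmorph1 mul0r mul1r addr0 subrKC -/(mid a b) => -> -> ->.
by rewrite [RHS]addrC addrA subrK.
Qed.

(** Replaces [f] by a function [A'] with a known primitive. It serves twice: with [A'] the affine
    approximation of [f] in Goursat's theorem, and with [A'] constant to differentiate [segint]. *)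
Lemma seg_approx f (A A' : R[i] -> R[i]) a b (M : R) :
  Hol f -> unit_disc a -> unit_disc b -> (forall w, cdiff A w (A' w)) ->
  (forall t, 0 <= t <= 1 ->
    normc (f (a + t%:C * (b - a)) - A' (a + t%:C * (b - a))) <= M) ->
  normc (seg f a b - (A b - A a)) <= M * normc (b - a).
Proof.
move=> hf a1 b1 dA fM; have [Phi dPhi E] := seg_primitive hf a1 b1.
have := E 0 1 itv0 itv1; rewrite rmorph0 rmorph1 mul0r mul1r addr0 subrKC => ->.
pose Psi (t : R) := Phi t - A (a + t%:C * (b - a)).
have -> : Phi 1 - Phi 0 - (A b - A a) = Psi 1 - Psi 0.
  rewrite /Psi rmorph0 rmorph1 mul0r mul1r addr0 subrKC.
  by ring.
have <- : M * normc (b - a) * 1 - M * normc (b - a) * 0 = M * normc (b - a).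
  by rewrite mulr0 mulr1 subr0.
apply: (@rder_le R Psi (fun t : R => f (a + t%:C * (b - a)) * (b - a) -
    A' (a + t%:C * (b - a)) * (b - a)) (fun t => M * normc (b - a) * t)
    (fun => M * normc (b - a))) => // t t01.
- by apply: rderB; [exact: dPhi|exact: rder_line].
- have := is_deriveZ (M * normc (b - a)) (is_derive_id t (1 : R)).
  by rewrite /GRing.scale /= mulr1.
- by rewrite -mulrBl normcM ler_wpM2r ?normc_ge0 ?fM.
Qed.

Definition tri f a b c := seg f a b + seg f b c + seg f c a.

Definition perimeter a b c := normc (b - a) + normc (c - b) + normc (a - c).

(** A radius [rho < 1] fixed once for all nested triangles keeps their limit point off the unit
    circle, where [f] need not be differentiable. *)
Definition in_ball (rho : R) a b c :=
  [/\ normc a <= rho, normc b <= rho & normc c <= rho].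

Lemma normc_mid (rho : R) a b : normc a <= rho -> normc b <= rho ->
  normc (mid a b) <= rho.
Proof.
move=> ha hb; rewrite -[X in normc X]subr0; apply: normc_segment.
- lra.
- by rewrite subr0.
- by rewrite subr0.
Qed.

Lemma normc_half z : normc ((2^-1 : R)%:C * z) = normc z / 2.
Proof. by rewrite normcM normc_real ger0_norm ?invr_ge0 // mulrC. Qed.

(* The candidates are the triangles cut out by the midpoints of the sides. *)
Lemma tri_bisect f (rho : R) a b c : Hol f -> rho < 1 -> in_ball rho a b c ->
  exists a' b' c', [/\ in_ball rho a' b' c',
    normc (tri f a b c) <= 4 * normc (tri f a' b' c'),
    perimeter a' b' c' <= perimeter a b c / 2 &
    normc (a' - a) <= perimeter a b c].
Proof.
move=> hf rho1 [ra rb rc].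
pose m1 := mid a b; pose m2 := mid b c; pose m3 := mid c a.
have r1 : normc m1 <= rho by exact: normc_mid.
have r2 : normc m2 <= rho by exact: normc_mid.
have r3 : normc m3 <= rho by exact: normc_mid.
have D x : normc x <= rho -> unit_disc x.
  by move=> xr; apply/unit_discE; exact: le_lt_trans rho1.
have split4 : tri f a b c = tri f a m1 m3 + tri f m1 b m2 + tri f m2 c m3 +
    tri f m1 m2 m3.
  rewrite /tri (seg_mid hf (D _ ra) (D _ rb)) (seg_mid hf (D _ rb) (D _ rc)).
  rewrite (seg_mid hf (D _ rc) (D _ ra)) -/m1 -/m2 -/m3.
  rewrite (seg_rev hf (D _ r1) (D _ r2)) (seg_rev hf (D _ r2) (D _ r3)).
  by rewrite (seg_rev hf (D _ r3) (D _ r1)); ring.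
have nsplit : normc (tri f a b c) <= normc (tri f a m1 m3) +
   normc (tri f m1 b m2) + normc (tri f m2 c m3) + normc (tri f m1 m2 m3).
  rewrite split4; apply: le_trans (le_normcD _ _) _; rewrite lerD2r.
  apply: le_trans (le_normcD _ _) _; rewrite lerD2r.
  exact: le_normcD.
have [e1 e2 e3 [e4 e5 e6 [e7 e8 e9]]] : [/\
   m1 - a = (2^-1 : R)%:C * (b - a), b - m1 = (2^-1 : R)%:C * (b - a),
   m2 - b = (2^-1 : R)%:C * (c - b) & [/\ c - m2 = (2^-1 : R)%:C * (c - b),
   m3 - c = (2^-1 : R)%:C * (a - c), a - m3 = (2^-1 : R)%:C * (a - c) &
   [/\ m1 - m3 = (2^-1 : R)%:C * (b - c), m2 - m1 = (2^-1 : R)%:C * (c - a) &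
    m3 - m2 = (2^-1 : R)%:C * (a - b)]]].
  have h : (2^-1 : R)%:C = 2^-1 :> R[i] by rewrite fmorphV rmorph_nat.
  by rewrite /m1 /m2 /m3 /mid h; do ?split; field.
have bc : normc (b - c) = normc (c - b) by exact: normcB.
have ca : normc (c - a) = normc (a - c) by exact: normcB.
have ab : normc (a - b) = normc (b - a) by exact: normcB.
have h1 := normc_ge0 (b - a); have h2 := normc_ge0 (c - b).
have h3 := normc_ge0 (a - c).
have [t1|t1] := leP (normc (tri f a b c)) (4 * normc (tri f a m1 m3)).
  exists a, m1, m3; split => //; last first.
    by rewrite subrr /normc /= expr0n addr0 sqrtr0 /perimeter !addr_ge0.
  rewrite /perimeter (normcB m3) e1 e6 e7 !normc_half bc; lra.
have [t2|t2] := leP (normc (tri f a b c)) (4 * normc (tri f m1 b m2)).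
  exists m1, b, m2; split => //; last by rewrite e1 normc_half /perimeter; lra.
  rewrite /perimeter (normcB m1 m2) e2 e3 e8 !normc_half ca; lra.
have [t3|t3] := leP (normc (tri f a b c)) (4 * normc (tri f m2 c m3)).
  exists m2, c, m3; split => //.
    rewrite /perimeter (normcB m2 m3) e4 e5 e9 !normc_half ab; lra.
  have -> : m2 - a = (2^-1 : R)%:C * (b - a) + (2^-1 : R)%:C * (c - a).
    by rewrite -e8 -e1; ring.
  apply: le_trans (le_normcD _ _) _; rewrite !normc_half ca /perimeter; lra.
exists m1, m2, m3; split => //; first lra.
  rewrite /perimeter e7 e8 e9 !normc_half bc ca ab; lra.
by rewrite e1 normc_half /perimeter; lra.
Qed.

(** The intervals of centre [x n] and half-length [2 * C / 2 ^+ n] are nested, since halving this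
    length gives back exactly the allowed step. The supremum of their left ends lies in all of them,
    which gives the rate together with the limit. *)
Lemma geometric_cauchy (x : nat -> R) (C : R) : 0 <= C ->
  (forall n, `|x n.+1 - x n| <= C / 2 ^+ n) ->
  exists l, forall n, `|l - x n| <= 2 * C / 2 ^+ n.
Proof.
move=> C0 hx.
pose u n := x n - 2 * C / 2 ^+ n; pose v n := x n + 2 * C / 2 ^+ n.
have E n : 2 * C / 2 ^+ n.+1 = C / 2 ^+ n :> R.
  by rewrite exprS; field; rewrite expf_neq0.
have un : nondecreasing_seq u.
  apply/nondecreasing_seqP => n; rewrite /u E.
  by have := hx n; rewrite ler_norml => /andP[]; lra.
have vn : nonincreasing_seq v.
  apply/nonincreasing_seqP => n; rewrite /v E.
  by have := hx n; rewrite ler_norml => /andP[]; lra.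
have uv n : u n <= v n.
  have : 0 <= 2 * C / 2 ^+ n by rewrite divr_ge0 ?mulr_ge0 ?exprn_ge0.
  rewrite /u /v; lra.
have ub m : ubound (range u) (v m).
  move=> _ [n _ <-]; have nk := leq_maxl n m; have mk := leq_maxr n m.
  exact: le_trans (un _ _ nk) (le_trans (uv _) (vn _ _ mk)).
have su : has_sup (range u) by split; [exists (u 0); exists 0|exists (v 0)].
exists (sup (range u)) => n; rewrite ler_distl; apply/andP; split.
  by apply: ub_le_sup; [case: su|exists n].
by apply: ge_sup; [case: su|exact: ub].
Qed.

(** Nested triangles shrink to a point [z] of the disc, where [f] differs from an affine function by
    at most [e * |w - z|]. The affine part integrates to zero around a triangle, and the rest is at
    most [e] times the square of the size. This square decreases like [4 ^- n], which compensates
    the factor [4 ^+ n] of the bisections. *)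
Lemma goursat_triangle f a b c : Hol f ->
  unit_disc a -> unit_disc b -> unit_disc c -> tri f a b c = 0.
Proof.
move=> hf /unit_discE a1 /unit_discE b1 /unit_discE c1.
pose rho := Num.max (normc a) (Num.max (normc b) (normc c)).
have rho1 : rho < 1 by rewrite !gt_max a1 b1.
(* A total function, so that it can be iterated; a triangle outside the ball is sent to itself. *)
have [|F HF] := @choice (R[i] * R[i] * R[i]) (R[i] * R[i] * R[i])
  (fun x y => in_ball rho x.1.1 x.1.2 x.2 -> [/\ in_ball rho y.1.1 y.1.2 y.2,
    normc (tri f x.1.1 x.1.2 x.2) <= 4 * normc (tri f y.1.1 y.1.2 y.2),
    perimeter y.1.1 y.1.2 y.2 <= perimeter x.1.1 x.1.2 x.2 / 2 &
    normc (y.1.1 - x.1.1) <= perimeter x.1.1 x.1.2 x.2]).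
  move=> x; have [xin|xout] := pselect (in_ball rho x.1.1 x.1.2 x.2).
    have [a' [b' [c' H]]] := tri_bisect hf rho1 xin.
    by exists (a', b', c').
  by exists x.
pose X n := iter n F (a, b, c); pose P := perimeter a b c.
have P0 : 0 <= P by rewrite /P /perimeter !addr_ge0 ?normc_ge0.
have HX n : [/\ in_ball rho (X n).1.1 (X n).1.2 (X n).2,
    normc (tri f a b c) <= 4 ^+ n * normc (tri f (X n).1.1 (X n).1.2 (X n).2) &
    perimeter (X n).1.1 (X n).1.2 (X n).2 <= P / 2 ^+ n].
  elim: n => [|n [i1 i2 i3]].
    split => /=; last by rewrite expr0 divr1.
      by split; rewrite /rho !le_max lexx ?orbT.
    by rewrite expr0 mul1r.
  have [j1 j2 j3 _] := HF _ i1; split => //.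
    apply: le_trans i2 _; rewrite exprSr -mulrA ler_wpM2l ?exprn_ge0 //.
  apply: le_trans j3 _; rewrite exprSr invfM mulrA ler_wpM2r ?invr_ge0 //.
have step n : normc ((X n.+1).1.1 - (X n).1.1) <= P / 2 ^+ n.
  by have [i1 _ i3] := HX n; have [_ _ _ /le_trans] := HF _ i1; apply.
have ReB (z w : R[i]) : complex.Re (z - w) = complex.Re z - complex.Re w.
  by case: z => ? ?; case: w.
have ImB (z w : R[i]) : complex.Im (z - w) = complex.Im z - complex.Im w.
  by case: z => ? ?; case: w.
have [|zx hzx] := @geometric_cauchy (fun n => complex.Re (X n).1.1) _ P0.
  by move=> n; rewrite -ReB (le_trans (normc_Re _)).
have [|zy hzy] := @geometric_cauchy (fun n => complex.Im (X n).1.1) _ P0.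
  by move=> n; rewrite -ImB (le_trans (normc_Im _)).
pose z := zx +i* zy.
(* The 4 is 2 + 2, one geometric tail for each coordinate. *)
have zX n : normc (z - (X n).1.1) <= 4 * P / 2 ^+ n.
  apply: le_trans (ler_normc_ReIm _) _; rewrite ReB ImB.
  apply: le_trans (lerD (hzx n) (hzy n)) _; lra.
(* The 5 is 4 + 1: the distance from [z] to the first vertex, plus the perimeter to reach the other
   vertices. *)
have small (e : R) : 0 < e -> exists n, 5 * P / 2 ^+ n < e.
  move=> e0; exists (Num.bound (e^-1 * (5 * P))).
  rewrite ltr_pdivrMr ?exprn_gt0 // -ltr_pdivrMl //.
  apply: lt_le_trans (archi_boundP _) _.
    by rewrite mulr_ge0 ?invr_ge0 ?mulr_ge0 // ltW.
  by rewrite -natrX ler_nat ltnW // ltn_expl.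
have z1 : unit_disc z.
  apply/unit_discE; have r1 : 0 < 1 - rho by rewrite subr_gt0.
  have [n Hn] := small _ r1; have := zX n; have [[h _ _] _ _] := HX n.
  have := lerB_normc z (X n).1.1.
  have : 4 * P / 2 ^+ n <= 5 * P / 2 ^+ n.
    by rewrite ler_wpM2r ?invr_ge0 ?exprn_ge0 // ler_wpM2r // ler_nat.
  lra.
have [d fd] := Hol_cdiff hf z1.
have key (e : R) : 0 < e -> normc (tri f a b c) <= e * (5 * P ^+ 2).
  move=> e0; have [r r0 Hr] := fd e e0; have [n Hn] := small _ r0.
  have [[ra rb rc] i2 i3] := HX n; have zn := zX n.
  set Q := P / 2 ^+ n in i3.
  have Q0 : 0 <= Q by rewrite divr_ge0 // exprn_ge0.
  move: ra rb rc i2 i3 zn.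
  set a' := (X n).1.1; set b' := (X n).1.2; set c' := (X n).2.
  move=> ra rb rc i2 i3 zn.
  have {}zn : normc (a' - z) <= 4 * Q by rewrite normcB /Q mulrA.
  have h1 := normc_ge0 (b' - a'); have h2 := normc_ge0 (c' - b').
  have h3 := normc_ge0 (a' - c').
  have i3' := i3; rewrite /perimeter in i3'.
  have za : normc (a' - z) <= 5 * Q by lra.
  have zb : normc (b' - z) <= 5 * Q.
    have := le_normcD (b' - a') (a' - z); rewrite addrA subrK; lra.
  have zc : normc (c' - z) <= 5 * Q.
    have := le_normcD (c' - a') (a' - z); rewrite addrA subrK (normcB c'); lra.
  have D x : normc x <= rho -> unit_disc x.
    by move=> xr; apply/unit_discE; exact: le_lt_trans rho1.
  have QE : 5 * Q < r by rewrite /Q mulrA.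
  (* A global primitive of the affine approximation [A'] of [f] at [z]; its increments along the
     three sides cancel. *)
  pose A w := f z * w + d * ((w - z) * (w - z) * 2^-1).
  pose A' w := f z + d * (w - z).
  have dA w : cdiff A w (A' w).
    have dB : cdiff (fun w => w - z) w (1 + 0).
      exact: cdiffD (cdiff_id _) (cdiff_cst _ _).
    have := cdiffD (cdiffM (cdiff_cst (f z) w) (cdiff_id w))
      (cdiffM (cdiff_cst d w) (cdiffM (cdiffM dB dB) (cdiff_cst 2^-1 w))).
    by congr cdiff; rewrite /A' addr0; field.
  have ap p q : normc p <= rho -> normc q <= rho -> normc (p - z) <= 5 * Q ->
     normc (q - z) <= 5 * Q ->
     normc (seg f p q - (A q - A p)) <= e * (5 * Q) * normc (q - p).
    move=> rp rq zp zq.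
    apply: (@seg_approx f A A') => //; [exact: D|exact: D|move=> t t01].
    have wz := normc_segment t01 zp zq.
    rewrite /A' opprD addrA; apply: le_trans (Hr _ (le_lt_trans wz QE)) _.
    by rewrite ler_wpM2l // ltW.
  have hab := ap _ _ ra rb za zb; have hbc := ap _ _ rb rc zb zc.
  have hca := ap _ _ rc ra zc za.
  have T : normc (tri f a' b' c') <= e * (5 * Q) * Q.
    have -> : tri f a' b' c' = seg f a' b' - (A b' - A a') +
       (seg f b' c' - (A c' - A b')) + (seg f c' a' - (A a' - A c')).
      by rewrite /tri; ring.
    apply: le_trans (le_normcD _ _) _.
    apply: le_trans (lerD (le_normcD _ _) (lexx _)) _.
    apply: le_trans (lerD (lerD hab hbc) hca) _.
    rewrite -!mulrDr; apply: ler_wpM2l => //.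
    by apply: mulr_ge0; [exact: ltW|apply: mulr_ge0].
  have n4 : 0 <= (4 : R) ^+ n by rewrite exprn_ge0.
  apply: le_trans i2 (le_trans (ler_wpM2l n4 T) _).
  have -> : (4 : R) ^+ n = 2 ^+ n * 2 ^+ n.
    by rewrite -exprMn; congr (_ ^+ _); rewrite -natrM.
  rewrite /Q le_eqVlt; apply/orP; left; apply/eqP; field.
  by rewrite expf_neq0.
apply/eqP; rewrite -normc_eq0 eq_le normc_ge0 andbT.
apply/ler_addgt0Pr => e e0; rewrite add0r.
have M0 : 0 < 5 * P ^+ 2 + 1 by rewrite ltr_pwDr // mulr_ge0 ?exprn_ge0.
apply: le_trans (key (e / (5 * P ^+ 2 + 1)) _) _; first by rewrite divr_gt0.
by rewrite mulrAC ler_pdivrMr // ler_wpM2l ?lerDl // ltW.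
Qed.

(** Goursat's theorem on the triangle with vertices 0, [z], [w] turns the increment of [segint f]
    into an integral over the short segment from [z] to [w], where [f] is close to [f z]. *)
Lemma cdiff_segint f z : Hol f -> unit_disc z -> cdiff (segint f) z (f z).
Proof.
move=> hf z1 e e0; have [d fd] := Hol_cdiff hf z1.
have [r r0 Hr] := cdiff_continuous fd e0.
have z1' : 0 < 1 - normc z by rewrite subr_gt0; apply/unit_discE.
exists (Num.min r (1 - normc z)); first by rewrite lt_min r0.
move=> w; rewrite lt_min => /andP[wr wz].
have w1 : unit_disc w.
  apply/unit_discE; have := lerB_normc w z; lra.
have D0 : unit_disc (0 : R[i]).
  by apply/unit_discE; rewrite /normc /= expr0n addr0 sqrtr0.
rewrite !segintE; have := goursat_triangle hf D0 z1 w1.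
rewrite /tri (seg_rev hf D0 w1) => /eqP; rewrite subr_eq0 => /eqP <-.
rewrite (addrC (seg f 0 z)) addrK.
have := @seg_approx f (fun w => f z * w) (fun=> f z) z w e hf z1 w1.
rewrite mulrBr; apply => [x|t /andP[t0 t1]].
  have := cdiffM (cdiff_cst (f z) x) (cdiff_id x).
  by rewrite mul0r add0r mulr1.
apply/ltW/Hr; rewrite addrAC subrr add0r normcM normc_real ger0_norm //.
by apply: le_lt_trans wr; rewrite ler_piMl ?normc_ge0.
Qed.

Lemma Hol_segint f : Hol f -> Hol (segint f).
Proof.
by move=> hf; apply: cdiff_Hol => z z1; exists (f z); exact: cdiff_segint.
Qed.

End goursat.

(** * Tonelli and Jensen on rectangles *)

Section integrals.
Variable R : realType.
Local Notation mu := (@lebesgue_measure R).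

(* The product sigma-algebra contains the open sets: a nonempty open set is the
   union of the rational boxes that it contains. *)
Lemma continuous_measurable_fun2 (h : R * R -> R) :
  continuous h -> measurable_fun setT h.
Proof.
move=> ch; apply: (measurability _ (RGenOInfty.measurableE R)).
move=> /= _ [_ [a ->]] <-; rewrite setTI.
set U := h @^-1` _.
pose box (q : rat * rat * rat * rat) : set (R * R) :=
  `]ratr q.1.1.1, ratr q.1.1.2[ `*` `]ratr q.1.2, ratr q.2[.
pose W q := if pselect (box q `<=` U) then box q else set0.
have -> : U = \bigcup_q W q.
  apply/seteqP; split => [[x y] Uxy|p [q _]]; last first.
    by rewrite /W; case: pselect => // + /= => /[apply].
  have oU : nbhs (x, y) U.
    apply: ch; apply: open_nbhs_nbhs; split; first exact: interval_open.
    by move: Uxy; rewrite /U /= in_itv /= andbT.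
  have [[A B] /= [/nbhs_ballP[r /= r0 rA] /nbhs_ballP[s /= s0 sB]] AB] := oU.
  have [q1 q1I] := @rat_in_itvoo R (x - r) x ltac:(by rewrite ltrBlDr ltrDl).
  have [q2 q2I] := @rat_in_itvoo R x (x + r) ltac:(by rewrite ltrDl).
  have [q3 q3I] := @rat_in_itvoo R (y - s) y ltac:(by rewrite ltrBlDr ltrDl).
  have [q4 q4I] := @rat_in_itvoo R y (y + s) ltac:(by rewrite ltrDl).
  rewrite !in_itv /= in q1I q2I q3I q4I.
  case/andP: q1I => ? ?; case/andP: q2I => ? ?.
  case/andP: q3I => ? ?; case/andP: q4I => ? ?.
  exists (q1, q2, q3, q4) => //; rewrite /W; case: pselect => /=.
    by move=> _; split; rewrite /= in_itv /=; apply/andP.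
  case; move=> [u v] [] /=; rewrite !in_itv /= => /andP[? ?] /andP[? ?].
  apply: AB; split => /=.
    by apply: rA; rewrite /ball /= ltr_distlC; apply/andP; split; lra.
  by apply: sB; rewrite /ball /= ltr_distlC; apply/andP; split; lra.
apply: countable_bigcupT_measurable; first exact: countableP.
move=> q; rewrite /W; case: pselect => [qU|qU] /=; last exact: measurable0.
by apply: measurableX; exact: measurable_itv.
Qed.

Section rectangle.
Variables (A B : set R) (K : R * R -> R).
Hypotheses (mA : measurable A) (mB : measurable B).
Hypotheses (mK : measurable_fun setT K) (K0 : forall p, 0 <= K p).

(** Extension by zero: Tonelli's theorem on the whole plane applies, and the partial integrals of
    [f] are the extensions by zero of those over [A] and [B]. *)
Let f : R * R -> \bar R := (EFin \o K) \_ (A `*` B).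

Let mf : measurable_fun setT f.
Proof.
apply/(measurable_restrictT _ _).1 => //; first exact: measurableX.
by apply: measurable_funTS; exact/measurable_EFinP.
Qed.

Let f0 p : (0 <= f p)%E.
Proof. by rewrite /f patchE; case: ifP => // _; rewrite lee_fin. Qed.

Let fF : (fun x => \int[mu]_y f (x, y))%E =
  (fun x => \int[mu]_(y in B) (K (x, y))%:E)%E \_ A.
Proof.
apply/funext => x; rewrite patchE; case: ifPn => xA.
  rewrite [RHS]integral_mkcond; apply: eq_integral => y _.
  rewrite /f !patchE in_setX /= xA /=; by case: ifP.
apply: integral0_eq => y _; rewrite /f patchE in_setX /=.
by rewrite (negbTE xA).
Qed.

Let fG : (fun y => \int[mu]_x f (x, y))%E =
  (fun y => \int[mu]_(x in A) (K (x, y))%:E)%E \_ B.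
Proof.
apply/funext => y; rewrite patchE; case: ifPn => yB.
  rewrite [RHS]integral_mkcond; apply: eq_integral => x _.
  rewrite /f !patchE in_setX /= yB andbT; by case: ifP.
apply: integral0_eq => x _; rewrite /f patchE in_setX /=.
by rewrite (negbTE yB) andbF.
Qed.

Lemma tonelli_rectangle :
  (\int[mu]_(x in A) \int[mu]_(y in B) (K (x, y))%:E =
   \int[mu]_(y in B) \int[mu]_(x in A) (K (x, y))%:E)%E.
Proof.
rewrite integral_mkcond [RHS]integral_mkcond -fF -fG.
exact: (fubini_tonelli (m1 := mu) (m2 := mu) f mf f0).
Qed.

Lemma measurable_fun_rectangle :
  measurable_fun B (fun y => \int[mu]_(x in A) (K (x, y))%:E)%E.
Proof.
apply/(measurable_restrictT _ mB); rewrite -fG.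
exact: (measurable_fun_fubini_tonelli_G (m1 := mu) f mf f0).
Qed.

End rectangle.

(** The graph of the power [p] lies above its tangent at [a]. This is Young's inequality with
    exponents [p] and [p / (p - 1)]; [p = 1], without a finite conjugate exponent, is an
    equality. *)
Lemma powR_tangent (p x a : R) : 1 <= p -> 0 <= x -> 0 <= a ->
  x * a `^ (p - 1) <= p^-1 * x `^ p + (1 - p^-1) * a `^ p.
Proof.
rewrite le_eqVlt => /orP[/eqP <-|p1] x0 a0.
  by rewrite subrr powRr0 invr1 mul1r subrr mul0r addr0 powRr1 // mulr1.
have p0 : 0 < p by rewrite (lt_trans _ p1).
have q0 : 0 < p / (p - 1) by rewrite divr_gt0 // subr_gt0.
have pm : p - 1 != 0 by rewrite subr_eq0 gt_eqF.
have := @conjugate_powR _ x (a `^ (p - 1)) p (p / (p - 1)) x0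
  (powR_ge0 _ _) p0 q0.
have -> : p^-1 + (p / (p - 1))^-1 = 1 by field; rewrite pm gt_eqF.
rewrite -powRrM mulrCA divff // mulr1 => /(_ erefl).
have -> : a `^ p / (p / (p - 1)) = (1 - p^-1) * a `^ p.
  by field; rewrite pm gt_eqF.
by rewrite (mulrC _ p^-1).
Qed.

(** The tangent inequality at the mean [a] of [h], integrated over an interval of length 1, has left
    side [a^p]; the multiple of [a^p] on the right is then absorbed. *)
Lemma jensen_powR01 (h : R -> R) (p : R) : 1 <= p ->
  (forall s, 0 <= h s) -> continuous h ->
  (((\int[mu]_(s in `[0%R, 1%R]) h s)%R `^ p)%:E <=
    \int[mu]_(s in `[0%R, 1%R]) (h s `^ p)%:E)%E.
Proof.
move=> p1 h0 ch; set a := (\int[mu]_(s in _) _)%R.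
have p0 : 0 < p by rewrite (lt_le_trans _ p1).
have ih : mu.-integrable `[0, 1] (EFin \o h).
  apply: continuous_compact_integrable; first exact: segment_compact.
  exact: continuous_subspaceT.
have a0 : 0 <= a by apply: Rintegral_ge0.
have mh : measurable_fun (`[0, 1] : set R) h.
  by apply: measurable_funTS; exact: continuous_measurable_fun.
have mhp : measurable_fun (`[0, 1] : set R) (fun s => (h s `^ p)%:E).
  apply/measurable_EFinP; apply: (@measurableT_comp _ _ _ _ _ _ (@powR R ^~ p));
    by [exact: measurable_powR|].
have p'0 : 0 <= p^-1 by rewrite invr_ge0 ltW.
have p'1 : 0 <= 1 - p^-1 by rewrite subr_ge0 invf_le1.
have aE : (\int[mu]_(s in `[0%R, 1%R]) (h s)%:E = a%:E)%E.
  rewrite /a /Rintegral fineK //; exact: integrable_fin_num.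
have I0 : (0 <= \int[mu]_(s in `[0%R, 1%R]) (h s `^ p)%:E)%E.
  by apply: integral_ge0 => s _; rewrite lee_fin powR_ge0.
have : (\int[mu]_(s in `[0%R, 1%R]) (a `^ (p - 1) * h s)%:E <=
   \int[mu]_(s in `[0%R, 1%R])
      (p^-1%:E * (h s `^ p)%:E + (cst ((1 - p^-1) * a `^ p)%:E) s))%E.
  apply: ge0_le_integral => //=.
  - by move=> s _; rewrite lee_fin mulr_ge0 ?powR_ge0.
  - by apply/measurable_EFinP; exact: measurable_funM.
  - apply: emeasurable_funD => //.
    by apply/measurable_EFinP; apply: measurable_funM => //;
      exact/measurable_EFinP.
  - move=> s _; rewrite -EFinM -EFinD lee_fin mulrC.
    exact: powR_tangent.
rewrite ge0_integralD //=; last 3 first.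
- by move=> s _; rewrite -EFinM lee_fin mulr_ge0 ?powR_ge0.
- by apply/measurable_EFinP; apply: measurable_funM => //;
    exact/measurable_EFinP.
- by move=> s _; rewrite lee_fin mulr_ge0 ?powR_ge0.
rewrite ge0_integralZl_EFin //; last by move=> s _; rewrite lee_fin powR_ge0.
rewrite integral_cst //= lebesgue_measure_itv /= lte_fin ltr01 sube0 mule1.
under eq_integral do rewrite EFinM.
rewrite ge0_integralZl_EFin //; last 3 first.
- by move=> s _; rewrite lee_fin.
- exact/measurable_EFinP.
- exact: powR_ge0.
rewrite aE -EFinM mulrC mulr_powRB1 //.
case: (\int[mu]_(s in _) _)%E I0 => [I||] //=; last by move=> *; rewrite leey.
rewrite !lee_fin => I0 H.
have : p^-1 * a `^ p <= p^-1 * I by lra.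
by rewrite ler_pM2l // invr_gt0.
Qed.

End integrals.

(** * Hardy means *)

Section hardy.
Variable R : realType.
Implicit Types (f F G : R[i] -> R[i]).
Local Notation mu := (@lebesgue_measure R).

Lemma normc_polar (r t : R) : normc (polar r t) = `|r|.
Proof.
by rewrite /normc /polar !exprMn -mulrDr cos2Dsin2 mulr1 sqrtr_sqr.
Qed.

Lemma polarM (s r t : R) : polar (s * r) t = s%:C * polar r t.
Proof.
by apply/eqP; rewrite eq_complex /= !mul0r subr0 addr0 !mulrA !eqxx.
Qed.

Lemma polar_disc (r t : R) : 0 <= r < 1 -> unit_disc (polar r t).
Proof.
by move=> /andP[r0 r1]; apply/unit_discE; rewrite normc_polar ger0_norm.
Qed.

(** The source [T] is arbitrary so as to cover an angle, a pair of scale and angle, and a parameter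
    on a ray. *)
Lemma continuous_normc_comp (T : topologicalType) F (d : R[i]) (x y : T -> R)
    (q : T) : cdiff F (x q +i* y q) d ->
  {for q, continuous x} -> {for q, continuous y} ->
  {for q, continuous (fun s => normc (F (x s +i* y s)))}.
Proof.
move=> /cdiff_continuous cF cx cy; apply/cvgrPdist_lt => e /cF[r r0 Hr].
have r2 : 0 < r / 2 by rewrite divr_gt0.
have /cvgrPdist_lt/(_ _ r2) nx := cx.
have /cvgrPdist_lt/(_ _ r2) ny := cy.
near=> s.
have hs : normc ((x s +i* y s) - (x q +i* y q)) < r.
  apply: le_lt_trans (ler_normc_ReIm _) _ => /=.
  rewrite (splitr r) ltrD // distrC; near: s; [exact: nx|exact: ny].
apply: le_lt_trans (Hr _ hs); rewrite ler_norml; apply/andP; split.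
  by rewrite lerNl opprB lerB_normc.
by rewrite normcB lerB_normc.
Unshelve. all: by end_near. Qed.

Lemma continuous_normc_polar G (r : R) : Hol G -> 0 <= r < 1 ->
  continuous (fun t => normc (G (polar r t))).
Proof.
move=> hG r01 t; have [d Gd] := Hol_cdiff hG (polar_disc t r01).
apply: (@continuous_normc_comp _ G d (fun t => r * cos t)
  (fun t => r * sin t) t Gd).
  by apply: continuousM; [exact: cst_continuous|exact: continuous_cos].
by apply: continuousM; [exact: cst_continuous|exact: continuous_sin].
Qed.

Lemma clamp_disc (r s : R) : 0 <= r < 1 -> 0 <= clamp s * r < 1.
Proof.
move=> /andP[r0 r1]; have /andP[s0 s1] := clamp_itv s.
rewrite mulr_ge0 //=; apply: le_lt_trans r1; exact: ler_piMl.
Qed.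

Lemma continuous_normc_polar2 G (r : R) : Hol G -> 0 <= r < 1 ->
  continuous (fun q : R * R => normc (G (polar (clamp q.1 * r) q.2))).
Proof.
move=> hG r01 q.
have [d Gd] := Hol_cdiff hG (polar_disc q.2 (clamp_disc q.1 r01)).
have c1 : {for q, continuous (fun q : R * R => clamp q.1 * r)}.
  apply: continuousM; last exact: cst_continuous.
  apply: continuous_comp; [exact: cvg_fst|exact: clamp_continuous].
apply: (@continuous_normc_comp _ G d
  (fun q : R * R => clamp q.1 * r * cos q.2)
  (fun q => clamp q.1 * r * sin q.2) q Gd); apply: (continuousM c1).
  apply: continuous_comp; [exact: cvg_snd|exact: continuous_cos].
apply: continuous_comp; [exact: cvg_snd|exact: continuous_sin].
Qed.

Lemma hardy_meanE (p : R) f (r : R) : hardy_mean p f r =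
  (\int[mu]_(t in `[0%R, (2 * pi)%R])
     ((2 * pi)^-1 * normc (f (polar r t)) `^ p)%:E)%E.
Proof. by apply: eq_integral => t _; rewrite mulrC. Qed.

Lemma HardyP (p : R) f : Hol f -> Hardy p f <->
  exists2 M : R, 0 <= M & forall r, 0 <= r < 1 -> (hardy_mean p f r <= M%:E)%E.
Proof.
move=> hf; split => [[_ fin]|[M M0 HM]].
  have ub r : 0 <= r < 1 -> (hardy_mean p f r <= hardy_normp p f)%E.
    by move=> r01; apply: ereal_sup_ubound; exists r.
  have m0 : (0 <= hardy_mean p f 0)%E.
    rewrite hardy_meanE; apply: integral_ge0 => t _.
    by rewrite lee_fin mulr_ge0 ?powR_ge0 // invr_ge0 mulr_ge0 // pi_ge0.
  have s0 : (0 <= hardy_normp p f)%E.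
    by apply: le_trans m0 (ub _ _); rewrite lexx ltr01.
  exists (fine (hardy_normp p f)); first exact: fine_ge0.
  by move=> r /ub; rewrite fineK // ge0_fin_numE.
split => //; apply: le_lt_trans (ltry M).
by apply: ge_ereal_sup => _ [r /= r01 <-]; exact: HM.
Qed.

(** The sum is at most three times its largest term [m], whose power occurs on the right. *)
Lemma powR_sum3 (p x y z : R) : 0 <= p -> 0 <= x -> 0 <= y -> 0 <= z ->
  (x + y + z) `^ p <= 3 `^ p * (x `^ p + y `^ p + z `^ p).
Proof.
move=> p0 x0 y0 z0.
have px := powR_ge0 x p; have py := powR_ge0 y p; have pz := powR_ge0 z p.
have H m : 0 <= m -> x <= m -> y <= m -> z <= m ->
    m `^ p <= x `^ p + y `^ p + z `^ p ->
    (x + y + z) `^ p <= 3 `^ p * (x `^ p + y `^ p + z `^ p).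
  move=> m0 xm ym zm; have p3 := powR_ge0 3 p.
  move=> /(ler_wpM2l p3); apply: le_trans; rewrite -powRM //.
  apply: ge0_ler_powR => //; rewrite ?nnegrE ?addr_ge0 ?mulr_ge0 //; lra.
have [xy|/ltW xy] := leP x y; have [yz|/ltW yz] := leP y z;
  have [xz|/ltW xz] := leP x z.
all: first [by apply: (H x) => //; lra | by apply: (H y) => //; lra |
            by apply: (H z) => //; lra].
Qed.

(** A radial average costs no more than [G] itself: after Jensen and the exchange of integrals, the
    inner integral is the mean of [G] on the circle of radius [s * r], bounded by the same [M].
    Hence the two terms [C1 * M] in the final bound. *)
Lemma hardy_dominated (p A B : R) F G : 1 <= p -> 0 <= A -> 0 <= B ->
  Hol F -> Hardy p G ->
  (forall r t, 0 <= r < 1 -> 0 <= t <= 2 * pi -> normc (F (polar r t)) <=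
     A + B * normc (G (polar r t)) +
     B * (\int[mu]_(s in `[0, 1]) normc (G (s%:C * polar r t)))) ->
  Hardy p F.
Proof.
move=> p1 A0 B0 hF HG FG; have hG := HG.1.
have p0 : 0 <= p by rewrite (le_trans _ p1).
have /(HardyP _ hG)[M M0 HM] := HG.
pose c : R := (2 * pi)^-1.
have pi0 : 0 < 2 * pi :> R by rewrite mulr_gt0 // pi_gt0.
have c0 : 0 <= c by rewrite invr_ge0 ltW.
pose C0 := 3 `^ p * A `^ p; pose C1 := 3 `^ p * B `^ p.
have C00 : 0 <= C0 by rewrite mulr_ge0 ?powR_ge0.
have C10 : 0 <= C1 by rewrite mulr_ge0 ?powR_ge0.
apply/HardyP => //; exists (C0 + C1 * M + C1 * M).
  have C1M : 0 <= C1 * M by exact: mulr_ge0.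
  by rewrite addr_ge0 // addr_ge0.
move=> r r01; pose I01 := (`[0%R, 1%R]%classic : set R).
pose I2 := (`[0%R, (2 * pi)%R]%classic : set R).
pose k (q : R * R) := normc (G (polar (clamp q.1 * r) q.2)).
pose K (q : R * R) := c * k q `^ p.
have ck : continuous k by exact: continuous_normc_polar2.
have k0 q : 0 <= k q by exact: normc_ge0.
have K0 q : 0 <= K q by rewrite mulr_ge0 // powR_ge0.
have mpow (d : measure_display) (T : measurableType d) (D : set T)
    (h : T -> R) :
    measurable_fun D h -> measurable_fun D (fun x => c * h x `^ p).
  move=> mh; apply: measurable_funM => //.
  exact: (@measurableT_comp _ _ _ _ _ _ (@powR R ^~ p)).
have mK : measurable_fun setT K.
  by apply: mpow; exact: continuous_measurable_fun2.
have mI1 : measurable I01 by exact: measurable_itv.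
have mI2 : measurable I2 by exact: measurable_itv.
have cont_s t : continuous (fun s => k (s, t)).
  move=> s; apply: (@continuous_comp _ _ _ (fun s => (s, t)) k); last exact: ck.
  by apply: (@cvg_pair _ _ _ _ (nbhs s) (nbhs t));
    [exact: cvg_id|exact: cvg_cst].
have mF : measurable_fun I2 (fun t => c * normc (F (polar r t)) `^ p).
  apply: mpow; apply: measurable_funTS; apply: continuous_measurable_fun.
  exact: continuous_normc_polar.
have mG : measurable_fun I2 (fun t => c * normc (G (polar r t)) `^ p).
  apply: mpow; apply: measurable_funTS; apply: continuous_measurable_fun.
  exact: continuous_normc_polar.
have mJ := measurable_fun_rectangle mI1 mI2 mK K0.
have point t : I2 t -> ((c * normc (F (polar r t)) `^ p)%:E <=
    cst (c * C0)%:E t + C1%:E * (c * normc (G (polar r t)) `^ p)%:E +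
    C1%:E * \int[mu]_(s in I01) (K (s, t))%:E)%E.
  rewrite /I2 /= in_itv /= => t2.
  set u := normc (G (polar r t)).
  have u0 : 0 <= u by exact: normc_ge0.
  pose v := (\int[mu]_(s in I01) k (s, t))%R.
  have v0 : 0 <= v by apply: Rintegral_ge0.
  have Fuv : normc (F (polar r t)) <= A + B * u + B * v.
    apply: le_trans (FG r t r01 t2) _; rewrite le_eqVlt; apply/orP; left.
    apply/eqP; congr (_ + _ * _); apply: eq_Rintegral => s.
    rewrite inE /I01 /= in_itv /= => s01.
    by rewrite /k /= clamp_id // polarM.
  have J : ((v `^ p)%:E <= \int[mu]_(s in I01) (k (s, t) `^ p)%:E)%E.
    exact: (jensen_powR01 p1 (fun s => k0 (s, t)) (cont_s t)).
  have -> : (\int[mu]_(s in I01) (K (s, t))%:E =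
     c%:E * \int[mu]_(s in I01) (k (s, t) `^ p)%:E)%E.
    rewrite /K; under eq_integral do rewrite EFinM.
    rewrite ge0_integralZl_EFin //.
      by move=> s _; rewrite lee_fin powR_ge0.
    apply/measurable_EFinP.
    apply: (@measurableT_comp _ _ _ _ _ _ (@powR R ^~ p)) => //.
    by apply: measurable_funTS; exact: continuous_measurable_fun.
  have cC : (0 <= (C1 * c)%:E)%E by rewrite lee_fin mulr_ge0.
  have := lee_wpmul2l cC J; rewrite (EFinM C1 c) -!muleA => J'.
  apply: (le_trans _ (leeD (lexx _) J')); rewrite -!EFinM -!EFinD lee_fin.
  have X : normc (F (polar r t)) `^ p <=
      3 `^ p * (A `^ p + (B * u) `^ p + (B * v) `^ p).
    apply: le_trans (powR_sum3 p0 A0 (mulr_ge0 B0 u0) (mulr_ge0 B0 v0)).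
    apply: ge0_ler_powR => //; rewrite nnegrE ?normc_ge0 //.
    by rewrite !addr_ge0 ?mulr_ge0.
  have := ler_wpM2l c0 X; rewrite !powRM // /C0 /C1; lra.
rewrite hardy_meanE -/c -/I2.
have P1 t : I2 t -> (0 <= C1%:E * (c * normc (G (polar r t)) `^ p)%:E)%E.
  by move=> _; rewrite -EFinM lee_fin !mulr_ge0 ?powR_ge0.
have P2 t : I2 t -> (0 <= \int[mu]_(s in I01) (K (s, t))%:E)%E.
  by move=> _; apply: integral_ge0 => s _; rewrite lee_fin.
have M1 : measurable_fun I2
    (fun t => C1%:E * (c * normc (G (polar r t)) `^ p)%:E)%E.
  by apply: measurable_funeM; exact/measurable_EFinP.
have M2 : measurable_fun I2
    (fun t => C1%:E * \int[mu]_(s in I01) (K (s, t))%:E)%E.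
  exact: measurable_funeM.
apply: (@le_trans _ _ (\int[mu]_(t in I2)
   (cst (c * C0)%:E t + C1%:E * (c * normc (G (polar r t)) `^ p)%:E +
    C1%:E * \int[mu]_(s in I01) (K (s, t))%:E))%E).
  apply: ge0_le_integral => //.
  - by move=> t _; rewrite lee_fin mulr_ge0 ?powR_ge0.
  - exact/measurable_EFinP.
  - by apply: emeasurable_funD => //; apply: emeasurable_funD.
rewrite ge0_integralD //; last 3 first.
- by move=> t It; rewrite adde_ge0 ?P1 // lee_fin mulr_ge0.
- exact: emeasurable_funD.
- by move=> t It; rewrite mule_ge0 ?P2 // lee_fin.
rewrite ge0_integralD //; last by move=> t It; rewrite lee_fin mulr_ge0.
rewrite integral_cst //= lebesgue_measure_itv /= lte_fin pi0 sube0 -EFinM.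
rewrite ge0_integralZl_EFin //; last 2 first.
- by move=> t _; rewrite lee_fin mulr_ge0 ?powR_ge0.
- exact/measurable_EFinP.
rewrite ge0_integralZl_EFin //.
rewrite !EFinD; apply: leeD; first apply: leeD.
- by rewrite lee_fin mulrAC /c mulVf ?mul1r // gt_eqF.
- rewrite -hardy_meanE (EFinM C1 M); apply: lee_wpmul2l;
    first by rewrite lee_fin.
  exact: HM.
- rewrite (EFinM C1 M); apply: lee_wpmul2l; first by rewrite lee_fin.
  rewrite -(tonelli_rectangle mI1 mI2 mK K0).
  apply: (@le_trans _ _ (\int[mu]_(s in I01) cst M%:E s)%E); last first.
    rewrite integral_cst //= lebesgue_measure_itv /= lte_fin ltr01.
    by rewrite sube0 mule1.
  apply: ge0_le_integral; first exact: mI1.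
  + by move=> s _; apply: integral_ge0 => t _; rewrite lee_fin.
  + have mK' : measurable_fun setT (fun q : R * R => K (q.2, q.1)).
      by apply: (measurableT_comp mK); exact: measurable_swap.
    exact: (measurable_fun_rectangle mI2 mI1 mK' (fun q => K0 (q.2, q.1))).
  + exact: measurable_cst.
  + move=> s _; rewrite /= /K /k /= -hardy_meanE; apply: HM.
    exact: clamp_disc.
Qed.

End hardy.

(** * Integration against a polynomial symbol *)

Section volterra.
Variable R : realType.
Implicit Types (f F G : R[i] -> R[i]) (z w d : R[i]) (D : {poly R[i]}).
Local Notation mu := (@lebesgue_measure R).

Lemma Tvolterra_poly D f :
  Tvolterra (fun z => D.[z]) f = segint (fun w => f w * (D^`()).[w]).
Proof.
rewrite /Tvolterra; congr segint; apply/funext => w; congr (_ * _).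
exact/cdiff_cderiv/cdiff_horner.
Qed.

Lemma Tvolterra_id f : Tvolterra (fun z => z) f = segint f.
Proof.
rewrite /Tvolterra; congr segint; apply/funext => w.
by rewrite (cdiff_cderiv (cdiff_id w)) mulr1.
Qed.

Lemma Hol_mul_poly f D : Hol f -> Hol (fun w => f w * D.[w]).
Proof.
move=> hf; apply: cdiff_Hol => z /(Hol_cdiff hf)[d fd].
by exists (d * D.[z] + f z * D^`().[z]); apply: cdiffM fd (cdiff_horner _ _).
Qed.

Lemma poly_bounded D :
  exists2 C : R, 0 <= C & forall w, normc w <= 1 -> normc D.[w] <= C.
Proof.
elim/poly_ind: D => [|D c [C C0 HC]].
  by exists 0 => // w _; rewrite horner0 /normc /= expr0n addr0 sqrtr0.
exists (C + normc c) => [|w w1]; first by rewrite addr_ge0 ?normc_ge0.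
rewrite !hornerE; apply: le_trans (le_normcD _ _) _; rewrite lerD2r normcM.
by apply: le_trans (HC _ w1); rewrite ler_piMr ?normc_ge0.
Qed.

Lemma rder_ray f z (t : R) d : cdiff f (t%:C * z) d ->
  rder (fun s => f (s%:C * z)) t (d * z).
Proof.
move=> fd; have -> : (fun s : R => f (s%:C * z)) = fun s => f (0 + s%:C * z).
  by apply/funext => s; rewrite add0r.
by apply: rder_line; rewrite add0r.
Qed.

Lemma unit_disc_ray z (t : R) : 0 <= t <= 1 -> unit_disc z ->
  unit_disc (t%:C * z).
Proof.
move=> /andP[t0 t1] /unit_discE z1; apply/unit_discE.
rewrite normcM normc_real ger0_norm //; apply: le_lt_trans z1.
by rewrite ler_piMl ?normc_ge0.
Qed.

Lemma continuous_normc_ray G z : Hol G -> unit_disc z ->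
  continuous (fun s => normc (G ((clamp s)%:C * z))).
Proof.
move=> hG z1 s.
have [d Gd] := Hol_cdiff hG (unit_disc_ray (clamp_itv s) z1).
case: z z1 Gd => x y z1 Gd.
have E u : (clamp u)%:C * (x +i* y) = (clamp u * x) +i* (clamp u * y).
  by apply/eqP; rewrite eq_complex /= !mul0r subr0 addr0 !eqxx.
have -> : (fun s => normc (G ((clamp s)%:C * (x +i* y)))) =
    (fun s => normc (G ((clamp s * x) +i* (clamp s * y)))).
  by apply/funext => u; rewrite E.
rewrite E in Gd.
apply: (@continuous_normc_comp _ _ G d (fun s => clamp s * x)
  (fun s => clamp s * y) s Gd).
  by apply: continuousM; [exact: clamp_continuous|exact: cst_continuous].
by apply: continuousM; [exact: clamp_continuous|exact: cst_continuous].
Qed.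

(** Only the part of the ray beyond [tau] is estimated, but the bound is the integral over the full
    ray, as [hardy_dominated] requires. *)
Lemma rder_ray_le (Phi phi : R -> R[i]) G z (C tau : R) :
  Hol G -> unit_disc z -> 0 <= C -> 0 <= tau <= 1 ->
  (forall t, tau <= t <= 1 -> rder Phi t (phi t)) ->
  (forall t, tau <= t <= 1 -> normc (phi t) <= C * normc (G (t%:C * z))) ->
  normc (Phi 1 - Phi tau) <=
    C * (\int[mu]_(s in `[0, 1]) normc (G (s%:C * z))).
Proof.
move=> hG z1 C0 /andP[tau0 tau1] dPhi phiG.
pose k s := normc (G ((clamp s)%:C * z)).
have ck : continuous k by exact: continuous_normc_ray.
have [K dK] := continuous_primitive 0 1 ck.
have -> : (\int[mu]_(s in `[0, 1]) normc (G (s%:C * z)))%R = K 1 - K 0.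
  transitivity (\int[mu]_(s in `[0, 1]) k s)%R.
    apply: eq_Rintegral => s; rewrite inE /= in_itv /= => s01.
    by rewrite /k clamp_id.
  by rewrite /Rintegral (Rint_FTC2 ltr01 (fun t _ => ck t) dK).
have CK (t : R) : 0 <= t <= 1 ->
    is_derive t (1 : R) (fun s => C * K s) (C * k t).
  by move=> /dK ?; exact: is_deriveZ.
have H1 : normc (Phi 1 - Phi tau) <= C * K 1 - C * K tau.
  apply: (@rder_le R Phi phi (fun s => C * K s) (fun t => C * k t)) => //.
    by move=> t /andP[t0 t1]; apply: CK; rewrite t1 (le_trans tau0).
  move=> t t01; apply: le_trans (phiG t t01) _.
  case/andP: t01 => t0 t1.
  by rewrite /k clamp_id // t1 (le_trans tau0).
(* Monotonicity of [C * K] on [[0, tau]], obtained from the mean value inequality for the zero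
   curve. *)
have H2 : normc ((0 : R[i]) - 0) <= C * K tau - C * K 0.
  apply: (@rder_le R (fun=> 0) (fun=> 0) (fun s => C * K s)
    (fun t => C * k t)) => //.
  - by move=> t _; split => /=; exact: is_derive_cst.
  - by move=> t /andP[t0 t1]; apply: CK; rewrite t0 (le_trans t1).
  - move=> t _; rewrite /normc /= expr0n addr0 sqrtr0.
    by rewrite mulr_ge0 ?normc_ge0.
have := normc_ge0 ((0 : R[i]) - 0); lra.
Qed.

Lemma Hardy_volterra_poly (p : R) f D : 1 <= p -> Hol f ->
  Hardy p (segint f) -> Hardy p (segint (fun w => f w * D.[w])).
Proof.
move=> p1 hf HF; have hfD := @Hol_mul_poly f D hf.
set F := segint f in HF *; set G := segint _.
have dF z : unit_disc z -> cdiff F z (f z) by exact: cdiff_segint.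
have dG z : unit_disc z -> cdiff G z (f z * D.[z]).
  by move=> z1; exact: (cdiff_segint hfD z1).
have [C1 C10 HC1] := poly_bounded D.
have [C2 C20 HC2] := poly_bounded D^`().
have hF : Hol F := Hol_segint hf.
apply: (@hardy_dominated R p (normc (G 0 - F 0 * D.[0])) (C1 + C2) G F p1
  (normc_ge0 _) (addr_ge0 C10 C20) (Hol_segint hfD) HF).
move=> r t r01 _; set z := polar r t.
have z1 : unit_disc z by exact: polar_disc.
pose Psi w := G w - F w * D.[w].
have dPsi w : unit_disc w -> cdiff Psi w (- (F w * D^`().[w])).
  move=> w1; have := cdiffD (dG w w1)
    (cdiffN (cdiffM (dF w w1) (cdiff_horner D w))).
  by congr cdiff; ring.
have := @rder_ray_le (fun s => Psi (s%:C * z))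
  (fun s => - (F (s%:C * z) * D^`().[s%:C * z]) * z) F z C2 0 hF z1 C20.
rewrite lexx ler01 rmorph1 rmorph0 mul0r mul1r.
set J := (\int[mu]_(s in _) _)%R => /(_ isT) H.
have J0 : 0 <= J by apply: Rintegral_ge0 => s _; exact: normc_ge0.
have {}H : normc (Psi z - Psi 0) <= C2 * J.
  apply: H => s s01; have sz := unit_disc_ray s01 z1.
    by apply: rder_ray; exact: dPsi.
  have hs : normc (s%:C * z) <= 1 by apply/ltW/unit_discE.
  have hz : normc z <= 1 by apply/ltW/unit_discE.
  rewrite mulNr -mulrN !normcM (normcN z).
  apply: (@le_trans _ _ (normc (F (s%:C * z)) * normc D^`().[s%:C * z])).
    by rewrite ler_piMr ?mulr_ge0 ?normc_ge0.
  by rewrite mulrC ler_wpM2r ?normc_ge0 // HC2.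
have hz : normc z <= 1 by apply/ltW/unit_discE.
have -> : G z = Psi 0 + F z * D.[z] + (Psi z - Psi 0) by rewrite /Psi; ring.
apply: le_trans (le_normcD _ _) _; apply: lerD; last first.
  by apply: le_trans H _; rewrite ler_wpM2r ?lerDr.
apply: le_trans (le_normcD _ _) _; rewrite lerD2l normcM mulrC.
by rewrite ler_wpM2r ?normc_ge0 // (le_trans (HC1 _ hz)) ?lerDl.
Qed.

(** In polar coordinates the closed disc of radius [rho] is the image of a compact rectangle. *)
Lemma Hol_bounded F (rho : R) : Hol F -> 0 < rho < 1 ->
  exists2 A : R, 0 <= A & forall r t, 0 <= r <= rho -> 0 <= t <= 2 * pi ->
    normc (F (polar r t)) <= A.
Proof.
move=> hF /andP[rho0 rho1].
have rho01 : 0 <= rho < 1 by rewrite ltW.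
have cF := continuous_normc_polar2 hF rho01.
have cK : compact ((`[0, 1] : set R) `*` (`[0, 2 * pi] : set R)).
  by apply: compact_setX; exact: segment_compact.
have /compact_bounded[M [_ HM]] :=
  continuous_compact (continuous_subspaceT cF) cK.
have M1 : M < `|M| + 1 by rewrite (le_lt_trans (ler_norm _)) ?ltrDl.
exists (`|M| + 1) => [|r t /andP[r0 rr] t2]; first by rewrite addr_ge0.
have q01 : 0 <= r / rho <= 1.
  by rewrite divr_ge0 ?(ltW rho0) //= ler_pdivrMr // mul1r.
have := HM _ M1 (normc (F (polar r t))); rewrite /= ger0_norm ?normc_ge0 //.
apply; exists (r / rho, t) => /=; first by split; rewrite /= in_itv.
by rewrite clamp_id // divfK // gt_eqF.
Qed.

(** The field [R[i]] is closed, so [D] splits and each factor is bounded below separately: a root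
    inside the disc pushes [rho] towards 1, a root outside leaves [rho] alone. The zero polynomial
    is ruled out because it vanishes at 1. *)
Lemma poly_lower_bound D :
  (forall l : R[i], D.[l] = 0 -> normc l <> 1) ->
  exists rho m : R, [/\ 0 < rho < 1, 0 < m &
    forall z, rho <= normc z <= 1 -> m <= normc D.[z]].
Proof.
move=> HD; have D0 : D != 0.
  apply/eqP => D0; apply: (HD 1); first by rewrite D0 horner0.
  by rewrite (normc_real 1) normr1.
have [s] := closed_field_poly_normal D; set L := lead_coef D => sE.
have : forall a, a \in s -> normc a <> 1.
  move=> a sa; apply: HD; apply/eqP.
  have : root (\prod_(z <- s) ('X - z%:P)) a by rewrite root_prod_XsubC.
  by rewrite /root sE hornerZ mulf_eq0 => ->; rewrite orbT.
have L0 : 0 < normc L.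
  by rewrite lt_def normc_ge0 andbT normc_eq0 lead_coef_eq0.
suff : (forall a, a \in s -> normc a <> 1) -> exists rho m : R,
    [/\ 0 < rho < 1, 0 < m & forall z, rho <= normc z <= 1 ->
     m <= normc (\prod_(a <- s) ('X - a%:P)).[z]].
  move=> /[apply] -[rho [m [rho01 m0 Hm]]].
  exists rho, (normc L * m); split=> // [|z /Hm mz].
    exact: mulr_gt0.
  by rewrite sE hornerZ normcM ler_wpM2l // ltW.
elim: s {sE} => [_|a s ih Hs].
  exists 2^-1, 1; split => //; first lra.
  by move=> z _; rewrite big_nil hornerC (normc_real 1) normr1.
have [b bs|rho [m [/andP[rho0 rho1] m0 Hm]]] := ih.
  by apply: Hs; rewrite inE bs orbT.
have /eqP := Hs a (mem_head _ _); rewrite neq_lt => /orP[a1|a1].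
  (* The midpoint between [|a|] and 1: beyond it, the distance to [a] is at least
     [(1 - |a|) / 2]. *)
  exists (Num.max rho ((1 + normc a) / 2)), ((1 - normc a) / 2 * m).
  split; first by rewrite lt_max rho0 gt_max rho1 /=; lra.
    by rewrite mulr_gt0 //; lra.
  move=> z; rewrite ge_max => /andP[/andP[z1 z2] z3].
  rewrite big_cons hornerM normcM !hornerE; apply: ler_pM.
  - by rewrite divr_ge0 // subr_ge0 ltW.
  - exact: ltW.
  - have := lerB_normc z a; lra.
  - by apply: Hm; rewrite z1.
exists rho, ((normc a - 1) * m); split; first by rewrite rho0.
  by rewrite mulr_gt0 // subr_gt0.
move=> z /andP[z1 z2]; rewrite big_cons hornerM normcM !hornerE.
apply: ler_pM.
- by rewrite subr_ge0 ltW.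
- exact: ltW.
- have := lerB_normc a z; rewrite (normcB a); lra.
- by apply: Hm; rewrite z1.
Qed.

Lemma Hardy_volterra_poly_inv (p : R) f D : 1 <= p -> Hol f ->
  (forall l : R[i], D.[l] = 0 -> normc l <> 1) ->
  Hardy p (segint (fun w => f w * D.[w])) -> Hardy p (segint f).
Proof.
move=> p1 hf HD HG; have hfD := @Hol_mul_poly f D hf.
set F := segint f; set G := segint _ in HG.
have dF z : unit_disc z -> cdiff F z (f z) by exact: cdiff_segint.
have dG z : unit_disc z -> cdiff G z (f z * D.[z]).
  by move=> z1; exact: (cdiff_segint hfD z1).
have hF : Hol F := Hol_segint hf.
have hG : Hol G := Hol_segint hfD.
have [rho [m [rho01 m0 Hm]]] := poly_lower_bound HD.
have [C C0 HC] := poly_bounded D^`().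
have [A1 A10 HA1] := Hol_bounded hF rho01.
have [A2 A20 HA2] := Hol_bounded hG rho01.
have im0 : 0 <= m^-1 by rewrite invr_ge0 ltW.
have Cm0 : 0 <= C * m^-1 ^+ 2 by rewrite mulr_ge0 ?exprn_ge0.
have Am0 : 0 <= A2 * m^-1 by rewrite mulr_ge0.
have invD w : m <= normc D.[w] -> normc D.[w]^-1 <= m^-1.
  move=> mD; rewrite normcV lef_pV2 // posrE; exact: lt_le_trans mD.
(* [A1 + A2 / m] bounds [F - G / D] on the circle of radius [rho], [1 / m] bounds [1 / D], and
   [C / m^2] bounds the derivative of [1 / D], the last two on the annulus. *)
apply: (@hardy_dominated R p (A1 + A2 * m^-1) (m^-1 + C * m^-1 ^+ 2) F G p1
  (addr_ge0 A10 Am0) (addr_ge0 im0 Cm0) hF HG).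
move=> r t r01 t2; set z := polar r t.
have z1 : unit_disc z by exact: polar_disc.
set J := (\int[mu]_(s in _) _)%R.
have J0 : 0 <= J by apply: Rintegral_ge0 => s _; exact: normc_ge0.
have /andP[r0 r1] := r01; have /andP[rho0 rho1] := rho01.
have nG := normc_ge0 (G z).
have [rrho|rrho] := leP r rho.
  have : normc (F z) <= A1 by apply: HA1; rewrite ?r0.
  have : 0 <= (m^-1 + C * m^-1 ^+ 2) * normc (G z)
    by rewrite mulr_ge0 ?addr_ge0.
  have : 0 <= (m^-1 + C * m^-1 ^+ 2) * J by rewrite mulr_ge0 ?addr_ge0.
  lra.
have rpos : 0 < r by exact: lt_trans rrho.
(* The parameter at which the ray towards [z] enters the annulus. *)
pose tau := rho / r.
have tau0 : 0 <= tau by rewrite divr_ge0 // ltW.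
have tau1 : tau <= 1 by rewrite ler_pdivrMr // mul1r ltW.
have tau01 : 0 <= tau <= 1 by rewrite tau0.
have nz : normc z = r by rewrite normc_polar ger0_norm.
have low s : tau <= s <= 1 -> m <= normc D.[s%:C * z].
  move=> /andP[s0 s1]; apply: Hm; have s0' := le_trans tau0 s0.
  rewrite normcM normc_real ger0_norm // nz; apply/andP; split.
    by rewrite -ler_pdivrMr.
  by rewrite (le_trans _ (ltW r1)) // ler_piMl.
have tauz : tau%:C * z = polar rho t by rewrite -polarM divfK // gt_eqF.
pose Psi w := F w - G w * D.[w]^-1.
have dPsi w : unit_disc w -> m <= normc D.[w] ->
    cdiff Psi w (G w * (D^`().[w] * (D.[w]^-1 * D.[w]^-1))).
  move=> w1 mD; have D0 : D.[w] != 0.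
    by rewrite -normc_eq0 gt_eqF // (lt_le_trans m0).
  have := cdiffD (dF w w1)
    (cdiffN (cdiffM (dG w w1) (cdiffV (cdiff_horner D w) D0))).
  by congr cdiff; field.
have := @rder_ray_le (fun s => Psi (s%:C * z))
  (fun s => G (s%:C * z) *
    (D^`().[s%:C * z] * (D.[s%:C * z]^-1 * D.[s%:C * z]^-1)) * z)
  G z (C * m^-1 ^+ 2) tau hG z1 Cm0 tau01.
rewrite rmorph1 mul1r -/J => H.
have {}H : normc (Psi z - Psi (tau%:C * z)) <= C * m^-1 ^+ 2 * J.
  apply: H => s s01.
    apply: rder_ray; apply: dPsi; last exact: low.
    apply: unit_disc_ray => //; case/andP: s01 => s0 ->.
    by rewrite (le_trans tau0).
  have s01' : 0 <= s <= 1.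
    by case/andP: s01 => s0 ->; rewrite (le_trans tau0).
  have hs : normc (s%:C * z) <= 1.
    by apply/ltW/unit_discE; exact: unit_disc_ray.
  have hz : normc z <= 1 by rewrite nz ltW.
  rewrite normcM; apply: le_trans (ler_piMr (normc_ge0 _) hz) _.
  rewrite normcM mulrC ler_wpM2r ?normc_ge0 // normcM.
  apply: ler_pM; rewrite ?normc_ge0 ?HC // normcM.
  by apply: ler_pM; rewrite ?normc_ge0 ?invD ?low.
have rho_in : 0 <= rho <= rho by rewrite lexx ltW.
have h1 := HA1 _ _ rho_in t2; have h2 := HA2 _ _ rho_in t2.
have one : tau <= (1 : R) <= 1.
  by apply/andP; split; [exact: tau1|exact: lexx].
have mz := low 1 one; rewrite rmorph1 mul1r in mz.
have mtau : m <= normc D.[polar rho t].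
  by rewrite -tauz; apply: low; apply/andP; split; [exact: lexx|exact: tau1].
rewrite tauz in H.
have h3 : normc (G z * D.[z]^-1) <= m^-1 * normc (G z).
  by rewrite normcM mulrC ler_wpM2r ?normc_ge0 // invD.
have h4 : normc (G (polar rho t) * D.[polar rho t]^-1) <= A2 * m^-1.
  by rewrite normcM; apply: ler_pM; rewrite ?normc_ge0 ?invD.
have -> : F z = F (polar rho t) - G (polar rho t) * D.[polar rho t]^-1 +
    (Psi z - Psi (polar rho t)) + G z * D.[z]^-1 by rewrite /Psi; ring.
apply: le_trans (le_normcD _ _) _.
apply: le_trans (lerD (le_normcD _ _) (lexx _)) _.
apply: le_trans (lerD (lerD (ler_normcB _ _) (lexx _)) (lexx _)) _.
have h5 : 0 <= C * m^-1 ^+ 2 * normc (G z) by rewrite mulr_ge0.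
have h6 : 0 <= m^-1 * J by rewrite mulr_ge0.
have -> : A1 + A2 * m^-1 + (m^-1 + C * m^-1 ^+ 2) * normc (G z) +
    (m^-1 + C * m^-1 ^+ 2) * J = A1 + A2 * m^-1 + C * m^-1 ^+ 2 * J +
    m^-1 * normc (G z) + (C * m^-1 ^+ 2 * normc (G z) + m^-1 * J) by ring.
apply: le_trans (lerD (lerD (lerD h1 h4) H) h3) _.
by rewrite lerDl addr_ge0.
Qed.

End volterra.

(** * Distances to a boundary point *)

Section boundary_zero.
Variable R : realType.
Implicit Types (f F G : R[i] -> R[i]) (z w d l : R[i]) (D : {poly R[i]}).
Local Notation mu := (@lebesgue_measure R).

(** A weak form of Jordan's inequality, whose constant is [2 / pi]. Up to [pi / 4] the cosine is at
    least 1/2, hence [sin x >= x / 2]; beyond, monotonicity gives [sin x >= pi / 8 >= x / 4]. *)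
Lemma sin_ge_quarter (x : R) : 0 <= x <= pi / 2 -> x / 4 <= sin x.
Proof.
move=> /andP[x0 x2].
have c4 : 2^-1 <= cos (pi / 4) :> R.
  have c0 : 0 <= cos (pi / 4) :> R.
    apply: cos_ge0_pihalf; have := @pi_gt0 R; lra.
  have : cos (pi / 4) ^+ 2 = 2^-1 :> R.
    have := cosD (pi / 4 : R) (pi / 4); have := cos2Dsin2 (pi / 4 : R).
    have -> : pi / 4 + pi / 4 = pi / 2 :> R by field.
    rewrite cos_pihalf -!expr2; lra.
  move=> H; rewrite leNgt; apply/negP => c; have := ltr_pM c0 c0 c c.
  by rewrite -expr2 H; lra.
have dec (y : R) : 0 <= y <= pi / 4 -> 2^-1 <= cos y.
  move=> /andP[y0 y4]; apply: le_trans c4 _; rewrite leNgt ltr_cos -?leNgt //.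
    by rewrite in_itv /=; have := @pi_gt0 R; lra.
  by rewrite in_itv /=; have := @pi_gt0 R; lra.
have small (y : R) : 0 <= y <= pi / 4 -> y / 2 <= sin y.
  move=> /andP[y0 y4].
  have [c cI] := @MVT_segment R sin cos 0 y y0 (fun x _ => is_derive_sin x)
    (continuous_subspaceT (@continuous_sin R)).
  rewrite sin0 !subr0 => ->; move: cI; rewrite in_itv /= => /andP[k0 ky].
  by rewrite mulrC ler_wpM2r // dec // k0 (le_trans ky).
have [x4|x4] := leP x (pi / 4).
  by apply: le_trans (small x _); rewrite ?x0 //; lra.
apply: (@le_trans _ _ (pi / 8)); first lra.
apply: (@le_trans _ _ (sin (pi / 4))).
  apply: le_trans (small _ _); first lra.
  by rewrite lexx andbT; have := @pi_gt0 R; lra.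
rewrite leNgt ltr_sin -?leNgt ?ltW //.
  by rewrite in_itv /=; apply/andP; split; have := @pi_gt0 R; lra.
by rewrite in_itv /=; apply/andP; split; have := @pi_gt0 R; lra.
Qed.

(** [cos v = 1 - 2 sin(v/2)^2] and [sin(v/2) >= v/8] for [v >= 0]; 32 is [8^2 / 2]. *)
Lemma cos_le_quadratic (v : R) : - pi <= v <= pi -> cos v <= 1 - v ^+ 2 / 32.
Proof.
wlog v0 : v / 0 <= v => [H vpi|].
  have [v0|/ltW v0] := leP 0 v; first exact: H.
  by rewrite -cosN -[v ^+ 2]sqrrN; apply: H; lra.
move=> /andP[_ vpi]; have x2 : 0 <= v / 2 <= pi / 2 by lra.
have /andP[x0 _] := x2.
have := cosD (v / 2) (v / 2); have := cos2Dsin2 (v / 2).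
rewrite -splitr -!expr2 => c ->.
have s0 := sin_ge_quarter x2; have x4 : 0 <= v / 2 / 4 by rewrite divr_ge0.
have : (v / 2 / 4) ^+ 2 <= sin (v / 2) ^+ 2.
  by rewrite !expr2; apply: ler_pM.
rewrite !expr2 in c *; lra.
Qed.

Lemma polar_distE (theta r t : R) :
  normc (polar 1 theta - polar r t) ^+ 2 = 1 + r ^+ 2 - 2 * r * cos (t - theta).
Proof.
rewrite /normc /polar /= sqr_sqrtr ?addr_ge0 ?sqr_ge0 // cosB.
rewrite -[1 + _](_ : (cos theta ^+ 2 + sin theta ^+ 2) +
  r ^+ 2 * (cos t ^+ 2 + sin t ^+ 2) = _); first by ring.
by rewrite !cos2Dsin2 mulr1.
Qed.

(* A multiple of [2 * pi] brings [t - theta] into [[-pi, pi]]. *)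
Lemma polar_dist_ge (theta r t : R) : 0 <= theta < 2 * pi -> 0 <= r < 1 ->
  0 <= t <= 2 * pi -> exists2 s : R,
    s \in [:: theta; theta + 2 * pi; theta - 2 * pi] &
    ((1 - r) ^+ 2 + (t - s) ^+ 2) / 81 <=
      normc (polar 1 theta - polar r t) ^+ 2.
Proof.
move=> /andP[th0 th2] /andP[r0 r1] /andP[t0 t2].
have pi0 := @pi_gt0 R.
have [s sin_s [sv cs]] : exists2 s : R,
    s \in [:: theta; theta + 2 * pi; theta - 2 * pi] &
    - pi <= t - s <= pi /\ cos (t - s) = cos (t - theta).
  have [h1|h1] := leP (t - theta) pi.
    have [h2|h2] := leP (- pi) (t - theta).
      by exists theta; rewrite ?inE ?eqxx //; split => //; rewrite h2.
    exists (theta - 2 * pi); first by rewrite !inE eqxx !orbT.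
    split; first lra.
    have -> : t - (theta - 2 * pi) = t - theta + pi *+ 2.
      by rewrite mulr2n; ring.
    exact: cosD2pi.
  exists (theta + 2 * pi); first by rewrite !inE eqxx !orbT.
  split; first lra.
  have -> : t - theta = t - (theta + 2 * pi) + pi *+ 2.
    by rewrite mulr2n; ring.
  by rewrite cosD2pi.
exists s => //; rewrite polar_distE -cs.
set v := t - s in sv cs *; have := cos_le_quadratic sv.
have v16 : v ^+ 2 <= 16.
  have -> : 16 = 4 ^+ 2 :> R by rewrite -natrX.
  have p4 : pi <= 4 :> R by have := @pihalf_lt2 R; lra.
  rewrite -(real_normK (num_real v)); apply: lerXn2r; rewrite ?nnegrE //.
  by rewrite ler_norml; lra.
have v0 := sqr_ge0 v.
move=> /(ler_wpM2l r0) cv.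
(* For [r >= 1/2] the cosine term supplies [v ^+ 2 / 32]. For [r < 1/2] the term
   [(1 - r) ^+ 2 >= 1/4] has to dominate [v ^+ 2 <= 16] alone, which calls for a constant 65 = 1 +
   16 * 4; 81 leaves room. *)
have [r2|r2] := leP 2^-1 r.
  have := ler_wpM2r v0 r2; have := sqr_ge0 (1 - r); rewrite !expr2 in cv *; lra.
have e2 : 1 / 4 <= (1 - r) ^+ 2.
  have -> : 1 / 4 = 2^-1 ^+ 2 :> R by field.
  by apply: lerXn2r; rewrite ?nnegrE; lra.
have := mulr_ge0 r0 v0; rewrite !expr2 in cv e2 *; lra.
Qed.

(** Travel along the unit circle by an arc of length [t - theta], then radially by [1 - r]. This
    upper bound serves the divergence of means, [polar_dist_ge] their boundedness. *)
Lemma polar_dist_le (theta r t : R) : 0 <= r < 1 -> theta <= t ->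
  normc (polar 1 theta - polar r t) <= 1 - r + (t - theta).
Proof.
move=> /andP[r0 r1] tt.
have H : normc (polar 1 t - polar 1 theta) <= t - theta.
  apply: (@rder_le R (polar 1) (fun s => (- sin s) +i* cos s) id
    (fun=> 1)) => //.
  - move=> s _; split; rewrite /polar /=; under eq_fun do rewrite mul1r.
      exact: is_derive_cos.
    exact: is_derive_sin.
  - by move=> s _; rewrite /normc sqrrN addrC cos2Dsin2 sqrtr1.
have -> : polar 1 theta - polar r t =
    (polar 1 t - polar r t) - (polar 1 t - polar 1 theta) by ring.
apply: le_trans (ler_normcB _ _) _; apply: lerD => //.
have -> : polar 1 t - polar r t = polar (1 - r) t.
  by apply/eqP; rewrite eq_complex /= !mulrBl !eqxx.
by rewrite normc_polar ger0_norm // subr_ge0 ltW.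
Qed.

Lemma unit_circle_polar l : normc l = 1 ->
  exists2 theta : R, 0 <= theta < 2 * pi & l = polar 1 theta.
Proof.
case: l => x y l1.
have xy : x ^+ 2 + y ^+ 2 = 1.
  rewrite -[LHS]sqr_sqrtr ?addr_ge0 ?sqr_ge0 //.
  by rewrite -[X in X ^+ 2]/(normc (x +i* y)) l1 expr1n.
have x1 : -1 <= x <= 1.
  rewrite -ler_norml -(@ler_pXn2r _ 2) ?nnegrE // real_normK ?num_real //
    expr1n.
  by have := sqr_ge0 y; lra.
have pi0 := @pi_gt0 R.
have ca : cos (acos x) = x by rewrite acosK // in_itv.
have a0 := acos_ge0 x1; have api := acos_lepi x1.
have sa : sin (acos x) = `|y|.
  rewrite sin_acos // -sqrtr_sqr; congr Num.sqrt; lra.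
have [y0|y0] := leP 0 y.
  exists (acos x); first by rewrite a0; lra.
  by apply/eqP; rewrite eq_complex /= !mul1r ca sa ger0_norm ?eqxx.
exists (- acos x + pi *+ 2).
  rewrite mulr2n; apply/andP; split; first lra.
  suff : 0 < acos x by lra.
  rewrite lt_def a0 andbT.
  by apply/eqP => h; move: sa; rewrite h sin0 ltr0_norm // => /eqP;
    rewrite eq_sym oppr_eq0 lt_eqF.
by apply/eqP; rewrite eq_complex /= !mul1r cosD2pi sinD2pi cosN sinN ca sa
  ltr0_norm // opprK !eqxx.
Qed.

Lemma hardy_mean_le_primitive (p : R) F (K k : R -> R) (r : R) :
  Hol F -> 0 <= r < 1 ->
  (forall t, 0 <= t <= 2 * pi -> is_derive t (1 : R) K (k t)) ->
  (forall t, 0 <= t <= 2 * pi -> {for t, continuous k}) ->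
  (forall t, 0 <= t <= 2 * pi -> normc (F (polar r t)) `^ p <= k t) ->
  (hardy_mean p F r <= ((2 * pi)^-1 * (K (2 * pi) - K 0))%:E)%E.
Proof.
move=> hF r01 dK ck Fk; have pi0 : 0 < 2 * pi :> R
  by rewrite mulr_gt0 // pi_gt0.
have c0 : 0 <= (2 * pi)^-1 :> R by rewrite invr_ge0 ltW.
have FT : (\int[mu]_(t in `[0%R, (2 * pi)%R]) ((2 * pi)^-1 * k t)%:E =
    ((2 * pi)^-1 * K (2 * pi) - (2 * pi)^-1 * K 0)%:E)%E.
  apply: (@Rint_FTC2 R (fun t => (2 * pi)^-1 * k t)
    (fun t => (2 * pi)^-1 * K t)) => //.
    by move=> t /ck ?; apply: continuousM => //; exact: cst_continuous.
  by move=> t /dK ?; exact: is_deriveZ.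
rewrite mulrBr -FT hardy_meanE; apply: ge0_le_integral => //.
- by move=> t _; rewrite lee_fin mulr_ge0 ?powR_ge0.
- apply/measurable_EFinP; apply: measurable_funM => //.
  apply: (@measurableT_comp _ _ _ _ _ _ (@powR R ^~ p)) => //.
  apply: measurable_funTS; apply: continuous_measurable_fun.
  exact: continuous_normc_polar.
- apply/measurable_EFinP; apply: measurable_funM => //.
  apply: subspace_continuous_measurable_fun => //.
  by apply: continuous_in_subspaceT => t; rewrite inE /= in_itv /= => /ck.
- by move=> t; rewrite /= in_itv /= => t2; rewrite lee_fin ler_wpM2l // Fk.
Qed.

End boundary_zero.

(** * The double pole at a boundary point *)

Section pole.
Variable R : realType.
Implicit Types (f F G : R[i] -> R[i]) (z w d l : R[i]) (D h : {poly R[i]}).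
Local Notation mu := (@lebesgue_measure R).

(* A smooth substitute for the kernel [`|u| `^ (-1/2)] and its primitive. *)
Section kernel.
Variable e : R.
Hypothesis e0 : 0 < e.
Let X (u : R) := e + u * u.
Let a : R := - 4^-1.
Let P (u : R) := u * X u `^ a.
Let dX (u : R) := a * X u `^ (a - 1) * (u + u).
Let dP (u : R) := X u `^ a + u * dX u.

Let X0 u : 0 < X u.
Proof. by rewrite /X ltr_wpDr // -expr2 sqr_ge0. Qed.

Let is_derive_powX (b u : R) :
  is_derive u (1 : R) (fun s => X s `^ b) (b * X u `^ (b - 1) * (u + u)).
Proof.
apply: (@is_derive1_comp R (fun x => x `^ b) X); first exact: is_derive1_powR.
have := is_deriveD (is_derive_cst e u (1 : R))
  (is_deriveM (is_derive_id u (1 : R)) (is_derive_id u (1 : R))).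
by rewrite add0r /GRing.scale /= mulr1.
Qed.

Let is_derive_P u : is_derive u (1 : R) P (dP u).
Proof.
have := is_deriveM (is_derive_id u (1 : R)) (is_derive_powX a u).
by rewrite /GRing.scale /= mulr1 addrC.
Qed.

Let continuous_dP : continuous dP.
Proof.
have cX b : continuous (fun s => X s `^ b).
  by move=> u; exact: is_derive_continuous (is_derive_powX b u).
rewrite /dP /dX => u; apply: cvgD; first exact: cX.
apply: cvgM; first exact: cvg_id.
apply: cvgM; last by apply: cvgD; exact: cvg_id.
by apply: cvgM; [exact: cvg_cst|exact: cX].
Qed.

(** As [2 * a = - 1/2] and [u * u <= X u], the second term of [dP] removes at most half of the
    first. *)
Let le_dP u : X u `^ a <= 2 * dP u.
Proof.
have E : X u * X u `^ (a - 1) = X u `^ a.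
  rewrite -{1}[X u]powRr1 ?ltW // -powRD ?subrKC //.
  by rewrite (gt_eqF (X0 u)) implybT.
have : u * u * X u `^ (a - 1) <= X u `^ a.
  by rewrite -E ler_wpM2r ?powR_ge0 // /X lerDr ltW.
rewrite /dP /dX /a; set A := X u `^ (_ - 1); set B := X u `^ _; lra.
Qed.

Let P_le u : `|P u| <= X u `^ 4^-1.
Proof.
rewrite /P normrM (ger0_norm (powR_ge0 _ _)).
have -> : X u `^ 4^-1 = X u `^ 2^-1 * X u `^ a.
  rewrite -powRD; last by rewrite (gt_eqF (X0 u)) implybT.
  by congr (_ `^ _); rewrite /a; field.
rewrite ler_wpM2r ?powR_ge0 // powR12_sqrt; last exact: ltW.
by rewrite -sqrtr_sqr ler_wsqrtr // expr2 /X lerDr ltW.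
Qed.

(** With [e = (1 - r) ^+ 2], the bound on [P] stays uniform as [r] tends to 1: it comes from [|u|]
    being at most the square root of [e + u * u]. *)
Lemma kernel_primitive : exists P dP : R -> R, [/\
  (forall u, is_derive u (1 : R) P (dP u)), continuous dP,
  (forall u, (e + u * u) `^ (- 4^-1) <= 2 * dP u) &
  (forall u, `|P u| <= (e + u * u) `^ 4^-1)].
Proof. by exists P, dP; split. Qed.

End kernel.

Lemma pole_neq0 l w : normc l = 1 -> unit_disc w -> l - w != 0.
Proof.
move=> l1 /unit_discE w1; rewrite subr_eq0; apply/eqP => lw.
by move: w1; rewrite -lw l1 ltxx.
Qed.

Lemma cdiff_pole l w : l - w != 0 ->
  cdiff (fun w => (l - w)^-1) w ((l - w)^-1 * (l - w)^-1).
Proof.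
move=> lw; have := cdiffV (cdiffD (cdiff_cst l w) (cdiffN (cdiff_id w))) lw.
by congr cdiff; rewrite add0r opprK mul1r expr2 invfM.
Qed.

Definition pole2 l w := (l - w)^-1 * (l - w)^-1.

Lemma Hol_pole2 l : normc l = 1 -> Hol (pole2 l).
Proof.
move=> l1; apply: cdiff_Hol => w /(pole_neq0 l1) lw.
have := cdiffM (cdiff_pole lw) (cdiff_pole lw).
by exists (pole2 l w * (l - w)^-1 + (l - w)^-1 * pole2 l w).
Qed.

Lemma segint_pole2 l z : normc l = 1 -> unit_disc z ->
  segint (pole2 l) z = (l - z)^-1 - l^-1.
Proof.
move=> l1 z1; rewrite /segint.
rewrite (@cint_rder R (fun t : R => (l - t%:C * z)^-1)).
- by rewrite rmorph1 rmorph0 mul1r mul0r subr0.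
- move=> t t01; have tz := unit_disc_ray t01 z1.
  have [d dd] := Hol_cdiff (Hol_pole2 l1) tz.
  exact: rder_cont (rder_ray (cdiffM dd (cdiff_cst z _))).
- move=> t t01; have tz := unit_disc_ray t01 z1.
  exact: rder_ray (cdiff_pole (pole_neq0 l1 tz)).
Qed.

Lemma normc_segint_pole2 l z : normc l = 1 -> unit_disc z ->
  normc (segint (pole2 l) z) = normc z / normc (l - z).
Proof.
move=> l1 z1; rewrite segint_pole2 //.
have l0 : l != 0 by rewrite -normc_eq0 l1 oner_eq0.
have -> : (l - z)^-1 - l^-1 = z / (l * (l - z)).
  by field; rewrite l0 pole_neq0.
by rewrite normcM normcV normcM l1 mul1r.
Qed.

(** One side of the singularity is enough: the arc from [th] to [2 * pi] has positive length [L],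
    and there the primitive is at least [1 / (2 * (1 - r + t - th))] for [r >= 1/2]. The integral of
    this bound is a logarithm that grows without limit as [r] tends to 1. *)
Lemma notin_Hardy_pole2 (p : R) l : 1 <= p -> normc l = 1 ->
  ~ Hardy p (segint (pole2 l)).
Proof.
move=> p1 l1; have hF := Hol_segint (Hol_pole2 l1).
have p0 : 0 <= p by rewrite (le_trans _ p1).
move=> /(HardyP p hF)[M M0 HM].
have [th /andP[th0 th2] lE] := unit_circle_polar l1.
have pi0 : 0 < 2 * pi :> R by rewrite mulr_gt0 // pi_gt0.
pose c : R := (2 * pi)^-1; have c0 : 0 < c by rewrite invr_gt0.
pose L := 2 * pi - th; have L0 : 0 < L by rewrite subr_gt0.
have key (r : R) : 2^-1 <= r -> r < 1 ->
    c / 2 * (ln (1 - r + L) - ln (1 - r)) <= M + 1.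
  move=> r2 r1; have r01 : 0 <= r < 1 by rewrite r1 andbT; lra.
  pose e := 1 - r; have e0 : 0 < e by rewrite subr_gt0.
  have pos t : th <= t -> 0 < e + (t - th).
    by move=> tt; rewrite ltr_wpDr // subr_ge0.
  pose k t := c / 2 * (e + (t - th))^-1.
  pose N t := normc (segint (pole2 l) (polar r t)).
  have dA (t : R) : is_derive t (1 : R) (fun s : R => e + (s - th)) 1.
    have := is_deriveD (is_derive_cst e t (1 : R))
      (is_deriveB (is_derive_id t (1 : R)) (is_derive_cst th t (1 : R))).
    by rewrite subr0 add0r.
  have ck t : th <= t <= 2 * pi -> {for t, continuous k}.
    move=> /andP[/pos tp _]; apply: cvgM; first exact: cvg_cst.
    apply: cvgV; first by rewrite gt_eqF.
    exact: is_derive_continuous (dA t).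
  have FT : (\int[mu]_(t in `[th, (2 * pi)%R]) (k t)%:E =
      (c / 2 * ln (e + L) - c / 2 * ln e)%:E)%E.
    have -> : e + L = e + (2 * pi - th) by [].
    have -> : (c / 2 * ln e)%R = c / 2 * ln (e + (th - th)).
      by rewrite subrr addr0.
    apply: (@Rint_FTC2 R k (fun t => c / 2 * ln (e + (t - th)))) => //.
    move=> t /andP[/pos tp _]; apply: is_deriveZ.
    have := @is_derive1_comp R (@ln R) _ t _ _ (is_derive1_ln tp) (dA t).
    by rewrite mulr1.
  have kN t : th <= t -> k t <= c * N t `^ p + c.
    move=> tht; rewrite /N normc_segint_pole2 //; last exact: polar_disc.
    rewrite normc_polar ger0_norm; last by lra.
    set q := normc (l - polar r t).
    have q0 : 0 < q.
      by rewrite lt_def normc_ge0 andbT normc_eq0 pole_neq0 //;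
        exact: polar_disc.
    have qe : q <= e + (t - th) by rewrite /q lE; exact: polar_dist_le.
    have y : 2^-1 * (e + (t - th))^-1 <= r / q.
      apply: ler_pM => //; first by rewrite invr_ge0 ltW // pos.
      by rewrite lef_pV2 // posrE pos.
    (* Reduction to the exponent 1; the added 1 has mean 1 and accounts for [M + 1]. *)
    have yp : r / q <= (r / q) `^ p + 1.
      have rq0 : 0 <= r / q by rewrite divr_ge0 ?ltW //; lra.
      have [h1|h1] := leP 1 (r / q).
        by apply: le_trans (_ : (r / q) `^ p <= _);
          [exact: le1r_powR|rewrite lerDl].
      by apply: le_trans (ltW h1) _; rewrite lerDr powR_ge0.
    have := ler_wpM2l (ltW c0) (le_trans y yp); rewrite /k; lra.
  have mN : measurable_fun (`[0, 2 * pi] : set R) (fun t => c * N t `^ p).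
    apply: measurable_funM => //.
    apply: (@measurableT_comp _ _ _ _ _ _ (@powR R ^~ p)) => //.
    apply: measurable_funTS; apply: continuous_measurable_fun.
    exact: continuous_normc_polar.
  have sub : `[th, (2 * pi)%R]%classic `<=`
      (`[0%R, (2 * pi)%R]%classic : set R).
    by apply: subset_itvr; rewrite bnd_simp.
  have mk : measurable_fun (`[th, 2 * pi] : set R) k.
    apply: subspace_continuous_measurable_fun => //.
    apply: continuous_in_subspaceT => t; rewrite inE /= in_itv /=.
    exact: ck.
  have H : (\int[mu]_(t in `[th, (2 * pi)%R]) (k t)%:E <= (M + 1)%:E)%E.
    apply: (@le_trans _ _ (\int[mu]_(t in `[th, (2 * pi)%R])
        ((c * N t `^ p)%:E + cst c%:E t))%E).
      apply: ge0_le_integral => //.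
      - move=> t /=; rewrite in_itv /= => /andP[/pos tp _].
        by rewrite lee_fin mulr_ge0 ?invr_ge0 ?ltW // divr_gt0.
      - exact/measurable_EFinP.
      - apply: emeasurable_funD => //; apply/measurable_EFinP.
        exact: measurable_funS mN.
      - by move=> t /=; rewrite in_itv /= => /andP[tt _];
          rewrite -EFinD lee_fin kN.
    apply: (@le_trans _ _ (\int[mu]_(t in `[0%R, (2 * pi)%R])
        ((c * N t `^ p)%:E + cst c%:E t))%E).
      apply: ge0_subset_integral => //.
        by apply: emeasurable_funD => //; exact/measurable_EFinP.
      move=> t _; rewrite -EFinD lee_fin addr_ge0 ?mulr_ge0 ?powR_ge0 //;
        exact: ltW.
    rewrite ge0_integralD //; last 3 first.
    - by move=> t _; rewrite lee_fin mulr_ge0 ?powR_ge0 // ltW.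
    - exact/measurable_EFinP.
    - by move=> t _; rewrite lee_fin ltW.
    rewrite -hardy_meanE EFinD; apply: leeD; first exact: HM.
    rewrite integral_cst //= lebesgue_measure_itv /= lte_fin pi0 sube0 -EFinM.
    by rewrite lee_fin /c mulVf // gt_eqF.
  by move: H; rewrite FT lee_fin mulrBr.
pose Q := (M + 1) / (c / 2).
(* [e <= 1/2] keeps the radius [1 - e] at least 1/2, and [e < L * expR (- Q)] makes [ln L - ln e]
   exceed [Q]. *)
pose e := Num.min 2^-1 (L * expR (- Q) / 2).
have L2 : 0 < L * expR (- Q) by rewrite mulr_gt0 ?expR_gt0.
have e0 : 0 < e by rewrite lt_min invr_gt0 ltr0n divr_gt0.
have e2 : e <= 2^-1 by rewrite ge_min lexx.
have eL : e < L * expR (- Q).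
  by rewrite gt_min; apply/orP; right; lra.
have := key (1 - e); rewrite opprB subrKC => H.
have {}H : c / 2 * (ln (e + L) - ln e) <= M + 1 by apply: H; lra.
have l1' : ln e < ln L - Q.
  rewrite -(expRK (- Q)) -lnM ?posrE ?expR_gt0 //.
  by rewrite ltr_ln // posrE.
have eL0 : 0 < e + L := addr_gt0 e0 L0.
have l2 : ln L <= ln (e + L).
  by rewrite ler_ln ?posrE //; rewrite lerDr ltW.
have : Q < ln (e + L) - ln e by lra.
rewrite /Q ltr_pdivrMr; last by rewrite divr_gt0.
by rewrite mulrC ltNge H.
Qed.

(** The factor ['X - l%:P] cancels one of the two poles. Along the ray the integrand is then at most
    [C / |l - s z|], and the lower bound on [|l - s z|] has an inverse whose primitive is a
    logarithm. *)
Lemma segint_pole_bound l h : normc l = 1 ->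
  exists A C : R, [/\ 0 <= A, 0 <= C & forall z, unit_disc z ->
    normc (segint (fun w => pole2 l w * (h * ('X - l%:P)).[w]) z) <=
      A + C * ln (4 / normc (l - z))].
Proof.
move=> l1; have [C C0 HC] := poly_bounded h.
set D := h * _; have hfD := @Hol_mul_poly R (pole2 l) D (Hol_pole2 l1).
set V := segint _.
exists (normc (V 0)), (2 * C); split; [exact: normc_ge0|exact: mulr_ge0|].
move=> z z1; pose q := normc (l - z).
have q0 : 0 < q by rewrite lt_def normc_ge0 andbT normc_eq0 pole_neq0.
have hz : normc z < 1 by apply/unit_discE.
have q2 : q <= 2 by have := ler_normcB l z; rewrite l1 -/q; lra.
pose de := q / 2; have de0 : 0 < de by rewrite divr_gt0.
have pos (s : R) : s <= 1 -> 0 < 1 - s + de.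
  by move=> s1; rewrite ltr_wpDl // subr_ge0.
(* [`|l - s z|] dominates both [1 - s] and [de = `|l - z| / 2]. *)
have low (s : R) : 0 <= s <= 1 -> (1 - s + de) / 2 <= normc (l - s%:C * z).
  move=> /andP[s0 s1].
  have h1 := lerB_normc l (s%:C * z);
    rewrite normcM normc_real ger0_norm // l1 in h1.
  have sz : s * normc z <= s by rewrite ler_piMr // ltW.
  have h2 : q <= normc (l - s%:C * z) + (1 - s).
    rewrite /q (_ : l - z = l - s%:C * z - (1 - s)%:C * z); last first.
      by rewrite rmorphB rmorph1; ring.
    apply: le_trans (ler_normcB _ _) _; rewrite lerD2l normcM normc_real.
    by rewrite ger0_norm ?subr_ge0 // ler_piMr ?subr_ge0 // ltW.
  rewrite /de; lra.
have := @rder_le R (fun s => V (s%:C * z))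
  (fun s => pole2 l (s%:C * z) * D.[s%:C * z] * z)
  (fun s => - (2 * C) * ln (1 - s + de)) (fun s => 2 * C * (1 - s + de)^-1)
  0 1 ler01.
rewrite rmorph1 rmorph0 mul1r mul0r subr0 subrr add0r => H.
have {}H : normc (V z - V 0) <= - (2 * C) * ln de - - (2 * C) * ln (1 + de).
  apply: H => s s01.
  - by apply: rder_ray; apply: (cdiff_segint hfD); exact: unit_disc_ray.
  - case/andP: (s01) => s0 s1.
    have dA : is_derive s (1 : R) (fun s : R => 1 - s + de) (- 1).
      have := is_deriveD (is_deriveB (is_derive_cst (1 : R) s (1 : R))
        (is_derive_id s (1 : R))) (is_derive_cst de s (1 : R)).
      by rewrite sub0r addr0.
    have := is_deriveZ (- (2 * C))
      (@is_derive1_comp R (@ln R) _ s _ _ (is_derive1_ln (pos s s1)) dA).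
    by rewrite /GRing.scale /= mulrN1 mulrNN.
  - have sz := unit_disc_ray s01 z1; have lz := pole_neq0 l1 sz.
    have -> : pole2 l (s%:C * z) * D.[s%:C * z] * z =
        - (h.[s%:C * z] * z) * (l - s%:C * z)^-1.
      by rewrite /pole2 /D hornerM hornerXsubC; field.
    rewrite normcM normcN normcM normcV.
    case/andP: (s01) => s0 s1; have ps := pos s s1.
    have hs : normc (s%:C * z) <= 1 by apply/ltW/unit_discE.
    have -> : 2 * C * (1 - s + de)^-1 = C * ((1 - s + de) / 2)^-1.
      by field; rewrite gt_eqF.
    apply: ler_pM; rewrite ?mulr_ge0 ?invr_ge0 ?normc_ge0 //.
      apply: le_trans (HC _ hs); rewrite ler_piMr ?normc_ge0 //; exact: ltW.
    rewrite lef_pV2 ?posrE ?low ?divr_gt0 //.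
    by apply: lt_le_trans (low _ s01); rewrite divr_gt0.
(* Since [de = q / 2 <= 1]. Then [ln 2 - ln (q / 2)] is the [ln (4 / q)] of the statement. *)
have l2 : ln (1 + de) <= ln 2.
  by rewrite ler_ln ?posrE // ?addr_gt0 // /de; lra.
have -> : ln (4 / normc (l - z)) = ln 2 - ln de.
  rewrite -ln_div ?posrE //; congr ln; rewrite -/q /de; field; exact: lt0r_neq0.
rewrite -[V z](subrK (V 0)) addrC; apply: le_trans (le_normcD _ _) _.
rewrite lerD2l; apply: le_trans H _.
have C2 : 0 <= 2 * C by exact: mulr_ge0.
have := ler_wpM2l C2 l2; lra.
Qed.

(** Apply [ln x < x] to [x = y^(1/(2p))] and raise to the power [p]. *)
Lemma ln_powR_le (p y : R) : 1 <= p -> 1 <= y ->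
  ln y `^ p <= (2 * p) `^ p * y `^ 2^-1.
Proof.
move=> p1 y1; have p0 : 0 < p by rewrite (lt_le_trans _ p1).
have y0 : 0 < y by rewrite (lt_le_trans _ y1).
have p2 : 0 < 2 * p by rewrite mulr_gt0.
have -> : y `^ 2^-1 = (y `^ (2 * p)^-1) `^ p.
  by rewrite -powRrM; congr (_ `^ _); field; rewrite gt_eqF.
rewrite -powRM ?powR_ge0 //; last exact: ltW.
apply: ge0_ler_powR; rewrite ?nnegrE.
- exact: ltW.
- exact: ln_ge0.
- by rewrite mulr_ge0 ?powR_ge0 // ltW.
have := ln_sublinear (powR_gt0 (2 * p)^-1 y0); rewrite ln_powR.
by rewrite mulrC ltr_pdivrMr // mulrC => /ltW.
Qed.

(** The logarithmic bound and [ln_powR_le] reduce the integrand to the power -1/2 of [|l - z|],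
    hence to the smooth kernel centred at one of three angles. A sum of three translates majorizes
    it without knowing which centre applies, and its integral is given by values of [P] at the end
    points. *)
Lemma Hardy_pole2 (p : R) l h : 1 <= p -> normc l = 1 ->
  Hardy p (segint (fun w => pole2 l w * (h * ('X - l%:P)).[w])).
Proof.
move=> p1 l1; set D := h * _.
have hV := Hol_segint (@Hol_mul_poly R (pole2 l) D (Hol_pole2 l1)).
have p0 : 0 <= p by rewrite (le_trans _ p1).
have [A [C [A0 C0 HV]]] := segint_pole_bound h l1.
have [th th02 lE] := unit_circle_polar l1; have /andP[th0 th2] := th02.
have pi0 := @pi_gt0 R; have pi2 : 0 < 2 * pi :> R by rewrite mulr_gt0.
(* [1296 = 81 * 4 ^ 2], with the [81] of [polar_dist_ge], and
   [1 + (4 * pi) ^ 2 <= 257]; they are made opaque since [//] would unfold the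
   unary numerals. *)
have [N N0 NE] : exists2 N : R, 0 <= N & N = 1296.
  by exists 1296; [rewrite ler0n|].
have [N' N'0 N'E] : exists2 N' : R, 0 <= N' & N' = 257.
  by exists 257; [rewrite ler0n|].
(* The power of 0 appears because the three-term inequality [powR_sum3] is applied to two terms. *)
pose c1 := 3 `^ p * (A `^ p + 0 `^ p).
pose c2 := 3 `^ p * (C `^ p * ((2 * p) `^ p * N `^ 4^-1)).
have c10 : 0 <= c1 by rewrite mulr_ge0 ?powR_ge0 // addr_ge0 ?powR_ge0.
have c20 : 0 <= c2.
  by apply: mulr_ge0; [|apply: mulr_ge0; [|apply: mulr_ge0]]; exact: powR_ge0.
pose B : R := N' `^ 4^-1; have B0 : 0 <= B by exact: powR_ge0.
apply/(HardyP p hV).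
(* Three translates evaluated at two end points give six values of [P], each at most [B] in absolute
   value. *)
exists ((2 * pi)^-1 * (c1 * (2 * pi) + c2 * 2 * (6 * B))).
  apply: mulr_ge0; first by rewrite invr_ge0 ltW.
  apply: addr_ge0; first by rewrite mulr_ge0 // ltW.
  exact: mulr_ge0 (mulr_ge0 c20 (ler0n _ 2)) (mulr_ge0 (ler0n _ 6) B0).
move=> r r01; have /andP[r0 r1] := r01.
have e0 : 0 < (1 - r) ^+ 2 by rewrite exprn_gt0 // subr_gt0.
have [P [dP [HP cP leP leB]]] := kernel_primitive e0.
set e := (1 - r) ^+ 2 in e0 HP leP leB.
have dP0 u : 0 <= dP u.
  have := le_trans (powR_ge0 _ _) (leP u); lra.
have shift (s t : R) : is_derive t (1 : R) (fun t => P (t - s)) (dP (t - s)).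
  have dA : is_derive t (1 : R) (fun t : R => t - s) 1.
    have := is_deriveB (is_derive_id t (1 : R)) (is_derive_cst s t (1 : R)).
    by rewrite subr0.
  by have := @is_derive1_comp R P (fun t => t - s) t _ _ (HP _) dA;
    rewrite mulr1.
have cshift (s : R) : continuous (fun t => dP (t - s)).
  move=> t; apply: (@continuous_comp _ _ _ (fun t => t - s) dP); last exact: cP.
  by apply: cvgB; [exact: cvg_id|exact: cvg_cst].
(* When [th] is near 0 or [2 * pi], points at the opposite end of the interval of angles are also
   close to [l]; the translates account for them. *)
pose s1 := th + 2 * pi; pose s2 := th - 2 * pi.
pose K t := c1 * t + c2 * 2 * (P (t - th) + P (t - s1) + P (t - s2)).
pose k t := c1 + c2 * 2 * (dP (t - th) + dP (t - s1) + dP (t - s2)).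
have := @hardy_mean_le_primitive R p
  (segint (fun w => pole2 l w * D.[w])) K k r hV r01.
move=> H; apply: le_trans (H _ _ _) _.
- move=> t _; have dI := is_deriveZ c1 (is_derive_id t (1 : R)).
  have dS := is_deriveZ (c2 * 2)
    (is_deriveD (is_deriveD (shift th t) (shift s1 t)) (shift s2 t)).
  have := is_deriveD dI dS.
  by rewrite /GRing.scale /= mulr1.
- move=> t _; apply: cvgD; first exact: cvg_cst.
  apply: cvgM; first exact: cvg_cst.
  apply: cvgD; last exact: cshift.
  by apply: cvgD; exact: cshift.
- move=> t t02; have z1 : unit_disc (polar r t) by exact: polar_disc.
  have := HV _ z1; set q := normc (l - polar r t) => HVz.
  have q0 : 0 < q by rewrite lt_def normc_ge0 andbT normc_eq0 pole_neq0.
  have q2 : q <= 2.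
    have /unit_discE := z1; have := ler_normcB l (polar r t).
    rewrite l1 -/q; lra.
  have y1 : 1 <= 4 / q by rewrite ler_pdivlMr // mul1r; lra.
  have lny : 0 <= ln (4 / q) by exact: ln_ge0.
  have [s sin_s Hs] := polar_dist_ge th02 r01 t02.
  rewrite -lE -/q -/e in Hs.
  set X := e + (t - s) * (t - s).
  have X0 : 0 < X by rewrite ltr_wpDr // -expr2 sqr_ge0.
  have yX : (4 / q) `^ 2^-1 <= N `^ 4^-1 * X `^ (- 4^-1).
    have y0 : 0 <= 4 / q by rewrite divr_ge0 // ltW.
    have iX0 : 0 <= X^-1 by rewrite invr_ge0 ltW.
    have -> : (4 / q) `^ 2^-1 = ((4 / q) ^+ 2) `^ 4^-1.
      by rewrite -(powR_mulrn 2 y0) -powRrM; congr (_ `^ _); field.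
    have -> : X `^ (- 4^-1) = X^-1 `^ 4^-1.
      by rewrite -(powR_inv1 (ltW X0)) -powRrM mulN1r.
    have yX2 : (4 / q) ^+ 2 <= N * X^-1.
      rewrite NE ler_pdivlMr // expr_div_n mulrAC ler_pdivrMr ?exprn_gt0 //.
      move: Hs; rewrite [(t - s) ^+ 2]expr2 -/X; lra.
    rewrite -powRM //; apply: ge0_ler_powR yX2; rewrite ?nnegrE ?invr_ge0 //.
      exact: exprn_ge0.
    exact: mulr_ge0.
  have XW : X `^ (- 4^-1) <= 2 * (dP (t - th) + dP (t - s1) + dP (t - s2)).
    apply: le_trans (leP (t - s)) _; rewrite ler_pM2l //.
    move: sin_s; rewrite !inE => /or3P[] /eqP ->.
    + by rewrite -addrA lerDl addr_ge0.
    + by rewrite addrAC lerDr addr_ge0.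
    + by rewrite lerDr addr_ge0.
  apply: (@le_trans _ _ ((A + C * ln (4 / q) + 0) `^ p)).
    apply: ge0_ler_powR; rewrite ?nnegrE ?normc_ge0 ?addr0 //.
    by rewrite addr_ge0 ?mulr_ge0.
  apply: le_trans (powR_sum3 p0 A0 (mulr_ge0 C0 lny) (lexx 0)) _.
  rewrite powRM // /k.
  have h1 := ln_powR_le p1 y1.
  have h2 : (2 * p) `^ p * (4 / q) `^ 2^-1 <= (2 * p) `^ p *
      (N `^ 4^-1 * (2 * (dP (t - th) + dP (t - s1) + dP (t - s2)))).
    apply: ler_wpM2l; first exact: powR_ge0.
    by apply: le_trans yX _; apply: ler_wpM2l XW; exact: powR_ge0.
  have h3 := ler_wpM2l (powR_ge0 3 p)
    (ler_wpM2l (powR_ge0 C p) (le_trans h1 h2)).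
  rewrite /c1 /c2; lra.
- rewrite lee_fin; apply: ler_wpM2l; first by rewrite invr_ge0 ltW.
  have PB (t s : R) : - (4 * pi) <= t - s <= 4 * pi -> `|P (t - s)| <= B.
    move=> ts; apply: le_trans (leB _) _; apply: ge0_ler_powR;
      rewrite ?nnegrE ?invr_ge0 //.
      by apply: addr_ge0; [exact: ltW|rewrite -expr2 sqr_ge0].
    have ts16 : (t - s) ^+ 2 <= 256.
      have -> : 256 = 16 ^+ 2 :> R by rewrite -natrX.
      have p4 : pi <= 4 :> R by have := @pihalf_lt2 R; lra.
      rewrite -(real_normK (num_real (t - s))); apply: lerXn2r;
        rewrite ?nnegrE //.
      by rewrite ler_norml; lra.
    have e1 : e <= 1 by rewrite /e exprn_ile1 //; lra.
    by rewrite -expr2 N'E; lra.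
  have PB' (t s : R) : 0 <= t <= 2 * pi -> - (2 * pi) <= s <= 4 * pi ->
      - B <= P (t - s) <= B.
    by move=> t02 s02; rewrite -ler_norml; apply: PB; lra.
  have I0 : 0 <= (0 : R) <= 2 * pi by rewrite lexx ltW.
  have I2 : 0 <= (2 * pi : R) <= 2 * pi by rewrite lexx ltW.
  have sth : - (2 * pi) <= th <= 4 * pi by lra.
  have ss1 : - (2 * pi) <= s1 <= 4 * pi by rewrite /s1; lra.
  have ss2 : - (2 * pi) <= s2 <= 4 * pi by rewrite /s2; lra.
  have := PB' _ _ I0 sth; have := PB' _ _ I0 ss1; have := PB' _ _ I0 ss2.
  have := PB' _ _ I2 sth; have := PB' _ _ I2 ss1; have := PB' _ _ I2 ss2.
  rewrite /K; move: (P _) (P _) (P _) (P _) (P _) (P _) => x1 x2 x3 x4 x5 x6.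
  move=> /andP[? ?] /andP[? ?] /andP[? ?] /andP[? ?] /andP[? ?] /andP[? ?].
  have c22 : 0 <= c2 * 2 by exact: mulr_ge0.
  rewrite mulr0 add0r -addrA -mulrBr lerD2l; apply: ler_wpM2l => //; lra.
Qed.

End pole.

(** * Comparison of the two optimal domains *)

Theorem proposition5p6 (R : realType) (p : R) (g : {poly R[i]}) (hp : 1 <= p) :
  ((forall l : R[i], `|l| <= 1 -> (deriv g).[l] = 0 -> `|l| != 1) ->
     optdom (fun z => g.[z]) p = optdom (fun z => z) p)
  /\
  ((exists l : R[i], [/\ `|l| <= 1, (deriv g).[l] = 0 & `|l| = 1]) ->
     optdom (fun z => z) p `<` optdom (fun z => g.[z]) p).
Proof.
have sub : optdom (fun z => z) p `<=` optdom (fun z => g.[z]) p.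
  move=> f [hf Hf]; rewrite Tvolterra_id in Hf; split; first exact: hf.
  rewrite Tvolterra_poly.
  exact: (@Hardy_volterra_poly R p f (deriv g) hp hf Hf).
split=> [g'0|[l [_ g'l l1]]].
  have g'N0 l : (deriv g).[l] = 0 -> normc l <> 1.
    move=> g'l l1; have := g'0 l.
    by rewrite (normcE l) l1 => /(_ (lexx _) g'l) /eqP; apply.
  apply/seteqP; split; last exact: sub.
  move=> f [hf Hf]; rewrite Tvolterra_poly in Hf; split; first exact: hf.
  by rewrite Tvolterra_id; exact: (Hardy_volterra_poly_inv hp hf g'N0 Hf).
have nl : normc l = 1 by case: l1.
(* [h] may vanish at [l] again, or be zero when [g] is constant; only its boundedness on the disc
   matters. *)
have [h hE] : exists h, deriv g = h * ('X - l%:P) by apply/factor_theorem/rootP.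
split; first exact: sub.
move=> /(_ (pole2 l))[].
  split; first exact: Hol_pole2 nl.
  by rewrite Tvolterra_poly hE; exact: (@Hardy_pole2 R p l h hp nl).
move=> _; rewrite Tvolterra_id; exact: notin_Hardy_pole2 hp nl.
Qed.
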